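(* Let $m$ be a positive integer and let $(K,\partial_0,\dots,\partial_{m-1})$ be a field with $m$ commuting derivations. Then the following are equivalent: (1) $(K,\partial_0,\dots,\partial_{m-1})$ is an existentially closed model of the theory $m\text{-}\mathrm{DF}$ of fields with $m$ commuting derivations; (2) for all positive integers $r$ and $n$: if $K$ has a field extension $K(a_h^{\xi}\colon|\xi|\le 2r\land h<n)$ meeting the differential condition such that $|\sigma|\le r$ whenever $a_k^{\sigma}$ is a minimal separable leader, then the tuple $(a_h^{\xi}\colon|\xi|<2r\land h<n)$ has a specialization over $K$ of the form $(\partial^{\xi}b_h\colon|\xi|<2r\land h<n)$ for some tuple $(b_h\colon h<n)$ of elements of $K$.
   Context: $n$ denotes also $\{0,\dots,n-1\}$. For $\sigma\in\mathbb{N}^m$, $\partial^\sigma=\partial_0^{\sigma(0)}\cdots\partial_{m-1}^{\sigma(m-1)}$ and $|\sigma|=\sum_{i<m}\sigma(i)$; $\le$ is the componentwise order on $\mathbb{N}^m$; $\varepsilon_i$ is the characteristic function of $\{i\}$ in $\mathbb{N}^m$. The total order $\unlhd$ on $\mathbb{N}^m\times n$: $(\xi,k)\unlhd(\eta,g)$ iff $(|\xi|,k,\xi(0),\dots,\xi(m-2))$ is lexicographically $\le(|\eta|,g,\eta(0),\dots,\eta(m-2))$; $\lhd$ is the strict version. The extension meets the differential condition if: whenever $i<m$, $|\sigma|+1\le 2r$, $k<n$, and $f$ is a polynomial over $K$ in variables $(x_h^{\xi}\colon(\xi,h)\unlhd(\sigma,k))$ vanishing at $a=(a_h^{\xi}\colon(\xi,h)\unlhd(\sigma,k))$,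 then $\sum_{(\eta,g)\unlhd(\sigma,k)}\frac{\partial f}{\partial x_g^{\eta}}(a)\,a_g^{\eta+\varepsilon_i}+f^{\partial_i}(a)=0$, with $f^{\partial_i}$ being $f$ with $\partial_i$ applied to its coefficients. A generator $a_k^{\sigma}$ is a separable leader if it is separably algebraic over $K(a_h^{\xi}\colon(\xi,h)\lhd(\sigma,k))$, and a minimal separable leader if in addition no $a_k^{\rho}$ with $\rho\le\sigma$, $\rho\ne\sigma$, is a separable leader. A tuple $b$ is a specialization over $K$ of a tuple $a$ (indexed alike) if every polynomial over $K$ vanishing at $a$ vanishes at $b$. A model of a theory is existentially closed if every finite system of equations and inequations with parameters from it that is soluble in some extension model is soluble in it. *)

(* Defs.v *)
From HB Require Import structures.
From mathcomp Require Import all_boot all_order all_algebra all_field.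
From mathcomp Require Import mpoly.
Set Implicit Arguments. Unset Strict Implicit. Unset Printing Implicit Defensive.
Import Order.TTheory GRing.Theory.
Local Open Scope ring_scope.

Definition derivation (R : comRingType) (D : R -> R) : Prop :=
  (forall x y, D (x + y) = D x + D y) /\ (forall x y, D (x * y) = D x * y + x * D y).

Definition commuting_derivations (m : nat) (R : comRingType) (d : 'I_m -> R -> R) : Prop :=
  (forall i, derivation (d i)) /\ (forall i j x, d i (d j x) = d j (d i x)).

Inductive dterm (m N : nat) (K : Type) : Type :=
| DVar of 'I_N
| DConst of K
| DAdd of dterm m N K & dterm m N K
| DOpp of dterm m N K
| DMul of dterm m N K & dterm m N K
| DDer of 'I_m & dterm m N K.

Fixpoint deval (m N : nat) (K : Type) (L : ringType) (iota : K -> L)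
  (dL : 'I_m -> L -> L) (x : 'I_N -> L) (t : dterm m N K) : L :=
  match t with
  | DVar j => x j
  | DConst c => iota c
  | DAdd t1 t2 => deval iota dL x t1 + deval iota dL x t2
  | DOpp t1 => - deval iota dL x t1
  | DMul t1 t2 => deval iota dL x t1 * deval iota dL x t2
  | DDer i t1 => dL i (deval iota dL x t1)
  end.

Definition ex_closed_mDF (m : nat) (K : fieldType) (d : 'I_m -> K -> K) : Prop :=
  forall (N p q : nat) (E : 'I_p -> dterm m N K) (F : 'I_q -> dterm m N K),
    (exists (L : fieldType) (dL : 'I_m -> L -> L) (iota : {rmorphism K -> L}),
        commuting_derivations dL /\
        (forall i c, dL i (iota c) = iota (d i c)) /\
        exists x : 'I_N -> L,
          (forall j, deval iota dL x (E j) = 0) /\ (forall j, deval iota dL x (F j) != 0)) ->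
    exists x : 'I_N -> K,
      (forall j, deval id d x (E j) = 0) /\ (forall j, deval id d x (F j) != 0).

(* index set for the generators a_h^xi, |xi| <= 2r, h < n; a multi-index xi in
   N^m with |xi| <= 2r has all components <= 2r, so it is stored with values in
   'I_(2r).+1.  Elements with |xi| > 2r are junk and never used. *)
Notation Idx m r n := ({ffun 'I_m -> 'I_(2 * r).+1} * 'I_n)%type.

Definition absx (m b : nat) (xi : {ffun 'I_m -> 'I_b}) : nat := \sum_(i < m) (xi i : nat).

Fixpoint lexle (s t : seq nat) : bool :=
  match s, t with
  | [::], _ => true
  | _ :: _, [::] => false
  | x :: s', y :: t' => (x < y)%N || ((x == y) && lexle s' t')
  end.

Definition idx_key (m r n : nat) (v : Idx m r n) : seq nat :=
  absx v.1 :: (v.2 : nat) :: take m.-1 [seq (v.1 i : nat) | i <- enum 'I_m].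

Definition ile (m r n : nat) (v w : Idx m r n) : bool := lexle (idx_key v) (idx_key w).
Definition ilt (m r n : nat) (v w : Idx m r n) : bool := ile v w && (v != w).

Definition ishift (m r n : nat) (i : 'I_m) (v : Idx m r n) : Idx m r n :=
  ([ffun j => inord (v.1 j + (i == j))], v.2).

Notation IPoly K m r n := {mpoly K[#|{: Idx m r n}|]}.

Definition vars_in (K : ringType) (m r n : nat) (P : Idx m r n -> bool)
  (f : IPoly K m r n) : Prop :=
  forall mono, mono \in msupp f -> forall j, ~~ P (enum_val j) -> mono j = 0%N.

Definition evalI (K L : ringType) (iota : K -> L) (m r n : nat) (a : Idx m r n -> L)
  (f : IPoly K m r n) : L := mmap iota (fun j => a (enum_val j)) f.

Definition in_genfield (K L : fieldType) (iota : K -> L) (S : L -> Prop) (y : L) : Prop :=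
  forall P : {pred L}, divring_closed P -> (forall c, iota c \in P) ->
    (forall s, S s -> s \in P) -> y \in P.

Definition sep_alg_over (K L : fieldType) (iota : K -> L) (S : L -> Prop) (x : L) : Prop :=
  exists p : {poly L}, (forall i, in_genfield iota S p`_i) /\ separable_poly p /\ root p x.

Definition sep_leader (K L : fieldType) (iota : K -> L) (m r n : nat) (a : Idx m r n -> L)
  (s : Idx m r n) : Prop :=
  sep_alg_over iota (fun y => exists v, ilt v s /\ y = a v) (a s).

Definition min_sep_leader (K L : fieldType) (iota : K -> L) (m r n : nat) (a : Idx m r n -> L)
  (s : Idx m r n) : Prop :=
  sep_leader iota a s /\
  forall rho : {ffun 'I_m -> 'I_(2 * r).+1},
    (forall j, (rho j <= s.1 j)%N) -> rho != s.1 -> ~ sep_leader iota a (rho, s.2).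

Definition diff_condition (K L : fieldType) (m r n : nat) (d : 'I_m -> K -> K)
  (iota : K -> L) (a : Idx m r n -> L) : Prop :=
  forall (i : 'I_m) (s : Idx m r n), ((absx s.1).+1 <= 2 * r)%N ->
  forall f : IPoly K m r n, vars_in (fun v => ile v s) f -> evalI iota a f = 0 ->
    \sum_(v : Idx m r n | ile v s) evalI iota a (mderiv (enum_rank v) f) * a (ishift i v)
      + evalI iota a (map_mpoly (d i) f) = 0.

Definition dpow (m : nat) (K : Type) (d : 'I_m -> K -> K) (xi : 'I_m -> nat) (x : K) : K :=
  foldr (fun i y => iter (xi i) (d i) y) x (enum 'I_m).

Definition is_specialization (K L : fieldType) (m r n : nat) (d : 'I_m -> K -> K)
  (iota : K -> L) (a : Idx m r n -> L) (b : 'I_n -> K) : Prop :=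
  forall f : IPoly K m r n, vars_in (fun v => (absx v.1 < 2 * r)%N) f ->
    evalI iota a f = 0 ->
    evalI id (fun v => dpow d (fun i => (v.1 i : nat)) (b v.2)) f = 0.

(* Main.v *)
Require Import Defs.
From HB Require Import structures.
From mathcomp Require Import all_boot all_order all_algebra all_field.
From mathcomp Require Import mpoly ring zify.
From mathcomp Require finmap monalg.
From Stdlib Require Import Classical ClassicalEpsilon Wellfounded FunctionalExtensionality.
Set Implicit Arguments. Unset Strict Implicit. Unset Printing Implicit Defensive.
Import Order.TTheory GRing.Theory.
Local Open Scope ring_scope.

(** (2) implies (1): adjoin the inverses of the left-hand sides of the inequations to a
    solution in an extension and let a be the tuple of its derivatives; by Dickson's
    lemma there are finitely many minimal leaders, so a large r is admissible.

    (1) implies (2): let F = K(a_v : |v| < 2r). The differential condition gives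
    derivations D_i : F -> L. Call v a lead if it lies above a separable leader. The
    leads of order 2r are F-affine combinations of smaller non-leads of order 2r, and
    1 together with those non-leads is F-linearly independent, an F-linear dependence
    exhibiting a separable leader. (Non-leads of order 2r may be inseparably algebraic
    over F, an obstruction to prolonging further.) Replace them by independent
    transcendentals through the F-linear map so defined, and take new transcendentals
    t_v for all non-leads of higher order; Q is the field so generated over F. For a
    lead w of order > 2r choose a lead v with w = v + e_i and put c_w = D_i c_v. That
    D_i c_v does not depend on the choice follows by induction along the order: if
    w = v + e_i = v' + e_l and w - e_i - e_l is a lead, its c-value is separably
    algebraic over smaller ones, where [D_i, D_l] vanishes; otherwise the leaders
    below v and v', both of order at most r, have an lcm of order at most 2r < |w|,
    so one can go through some w - e_j with j different from i and l. Hence the D_i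
    commute on Q, and a finite basis of the ideal of a transfers the solution to K. *)

(** * Generated subfields and derivations *)

(** [in_genfield] quantifies over boolean predicates; excluded middle lets an arbitrary proposition
    serve as one. *)
Definition asb (P : Prop) : bool :=
  if excluded_middle_informative P then true else false.

Lemma asbP (P : Prop) : reflect P (asb P).
Proof. by rewrite /asb; case: excluded_middle_informative => h; constructor. Qed.

Lemma choice_fun (A B : Type) (R : A -> B -> Prop) :
  (forall x, exists y, R x y) -> exists f, forall x, R x (f x).
Proof.
move=> H; exists (fun x => proj1_sig (constructive_indefinite_description _ (H x))).
by move=> x; case: constructive_indefinite_description.
Qed.

Definition field_closed (L : fieldType) (P : L -> Prop) :=
  [/\ P 1, forall x y, P x -> P y -> P (x - y)
    & forall x y, P x -> P y -> P (x / y)].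

Section GeneratedField.
Variables (K : fieldType) (L : fieldType) (iota : {rmorphism K -> L}).
Implicit Types (S P : L -> Prop).

Lemma genfield_ind S P : field_closed P -> (forall c, P (iota c)) ->
  (forall s, S s -> P s) -> forall y, in_genfield iota S y -> P y.
Proof.
move=> [P1 PB PD] PK PS y /(_ [pred x | asb (P x)]) H; apply/asbP/H.
- by split=> [|x z|x z]; rewrite !inE; first (by apply/asbP);
    move=> /asbP hx /asbP hz; apply/asbP; auto.
- by move=> c; rewrite inE; apply/asbP.
- by move=> s /PS; rewrite inE => ?; apply/asbP.
Qed.

Lemma genfield_const S c : in_genfield iota S (iota c).
Proof. by move=> P _ + _; apply. Qed.

Lemma genfield_gen S s : S s -> in_genfield iota S s.
Proof. by move=> Ss P _ _; apply. Qed.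

Lemma genfield_closed S : field_closed (in_genfield iota S).
Proof.
split=> [P [P1 _ _] //|x y hx hy P HP HK HS|x y hx hy P HP HK HS];
  have [_ PB PD] := HP; [apply: PB|apply: PD]; by [apply: hx|apply: hy].
Qed.

Lemma genfield_sub S S' : (forall s, S s -> in_genfield iota S' s) ->
  forall y, in_genfield iota S y -> in_genfield iota S' y.
Proof.
move=> H; apply: genfield_ind H; first exact: genfield_closed.
by move=> c; exact: genfield_const.
Qed.
End GeneratedField.

Section FieldClosed.
Variables (L : fieldType) (P : L -> Prop).
Hypothesis HP : field_closed P.

Lemma fc1 : P 1. Proof. by case: HP. Qed.
Lemma fcB x y : P x -> P y -> P (x - y). Proof. by case: HP => _ PB _; apply: PB. Qed.
Lemma fc_div x y : P x -> P y -> P (x / y). Proof. by case: HP => _ _ PD; apply: PD. Qed.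
Lemma fc0 : P 0. Proof. by rewrite -(subrr 1); apply: fcB; exact: fc1. Qed.
Lemma fcN x : P x -> P (- x).
Proof. by move=> hx; rewrite -sub0r; apply: fcB => //; exact: fc0. Qed.
Lemma fcD x y : P x -> P y -> P (x + y).
Proof. by move=> hx hy; rewrite -(opprK y); exact: (fcB hx (fcN hy)). Qed.
Lemma fcV x : P x -> P x^-1.
Proof. by move=> hx; rewrite -(mul1r x^-1); exact: (fc_div fc1 hx). Qed.
Lemma fcM x y : P x -> P y -> P (x * y).
Proof. by move=> hx hy; rewrite -(invrK y); exact: (fc_div hx (fcV hy)). Qed.
Lemma fcX x n : P x -> P (x ^+ n).
Proof. by move=> hx; elim: n => [|n IH]; rewrite ?expr0 ?exprS; [exact: fc1|exact: fcM]. Qed.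
Lemma fc_sum (I : Type) (s : seq I) (Q : pred I) (f : I -> L) :
  (forall i, Q i -> P (f i)) -> P (\sum_(i <- s | Q i) f i).
Proof. by move=> H; apply: big_ind => //; [exact: fc0|exact: fcD]. Qed.
End FieldClosed.

Section SubfieldType.
Variables (L : fieldType) (P : {pred L}) (HP : divring_closed P).
(** The closure proof is a dummy argument: through it, instance inference finds the closure property
    of a predicate that is a subfield only by hypothesis. *)
Definition subfield_pred (_ : divring_closed P) : {pred L} := P.
HB.instance Definition _ := GRing.isDivringClosed.Build L (subfield_pred HP) HP.
Record subfield_of := SubfieldOf { subfield_val : L; _ : subfield_val \in subfield_pred HP }.
HB.instance Definition _ := [isSub for subfield_val].
HB.instance Definition _ := [Choice of subfield_of by <:].
HB.instance Definition _ := [SubChoice_isSubIntegralDomain of subfield_of by <:].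
HB.instance Definition _ := [SubIntegralDomain_isSubField of subfield_of by <:].
End SubfieldType.

Lemma field_closed_subfield (L : fieldType) (P : L -> Prop) : field_closed P ->
  exists (F : fieldType) (j : {rmorphism F -> L}), forall y, P y <-> exists x, j x = y.
Proof.
move=> [P1 PB PD].
have HP : divring_closed [pred x | asb (P x)].
  by split=> [|x z|x z]; rewrite !inE; first (by apply/asbP);
    move=> /asbP hx /asbP hz; apply/asbP; auto.
exists (subfield_of HP), (GRing.RMorphism.clone _ _ (val : subfield_of HP -> L) _).
move=> y; split.
  by move=> /asbP hy; exists (SubfieldOf (HP := HP) hy).
by move=> [[x /= hx] <-]; exact/asbP.
Qed.

Section DerivationAlong.
Variables (F L : fieldType) (j : {rmorphism F -> L}).

(** The values lie in L, an F-module through [j], and not in F: differentiating an element of K(a_v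
    : |v| < 2r) brings in generators of order 2r. *)
Definition deriv_along (D : F -> L) : Prop :=
  (forall x y, D (x + y) = D x + D y) /\
  (forall x y, D (x * y) = D x * j y + j x * D y).

Section Theory.
Variables (D : F -> L) (HD : deriv_along D).

Lemma dalD x y : D (x + y) = D x + D y. Proof. by case: HD. Qed.
Lemma dalM x y : D (x * y) = D x * j y + j x * D y. Proof. by case: HD. Qed.
Lemma dal0 : D 0 = 0.
Proof. by apply: (addrI (D 0)); rewrite -dalD !addr0. Qed.
Lemma dal1 : D 1 = 0.
Proof. by apply: (addrI (D 1)); rewrite addr0 -{3}(mulr1 1) dalM rmorph1 mulr1 mul1r. Qed.
Lemma dalN x : D (- x) = - D x.
Proof. by apply: (addrI (D x)); rewrite -dalD !subrr dal0. Qed.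
Lemma dalB x y : D (x - y) = D x - D y. Proof. by rewrite dalD dalN. Qed.
Lemma dalV x : D x^-1 = - D x / j x ^+ 2.
Proof.
have [->|x0] := eqVneq x 0; first by rewrite invr0 dal0 oppr0 mul0r.
have jx0 : j x != 0 by rewrite fmorph_eq0.
have : D (x * x^-1) = 0 by rewrite divff // dal1.
rewrite dalM fmorphV => /eqP; rewrite addrC addr_eq0 => /eqP h.
by apply: (mulfI jx0); rewrite h; field.
Qed.
Lemma dal_div x y : D (x / y) = D x / j y - j x / j y ^+ 2 * D y.
Proof. by rewrite dalM dalV fmorphV; ring. Qed.
Lemma dal_sum (I : Type) (s : seq I) (P : pred I) (f : I -> F) :
  D (\sum_(i <- s | P i) f i) = \sum_(i <- s | P i) D (f i).
Proof. by apply: big_morph; [exact: dalD|exact: dal0]. Qed.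
Lemma dalX x n : D (x ^+ n) = j x ^+ n.-1 *+ n * D x.
Proof.
elim: n => [|n IH]; first by rewrite expr0 dal1 mulr0n mul0r.
rewrite exprSr dalM IH rmorphXn /=.
case: n {IH} => [|n] /=; first by rewrite mulr0n !mul0r add0r.
by rewrite [in RHS]mulrS mulrDl addrC; congr (_ + _); rewrite exprSr -mulrnAl mulrAC.
Qed.

Lemma dal_horner (p : {poly F}) x :
  D p.[x] = \sum_(k < size p) D p`_k * j x ^+ k + (map_poly j p)^`().[j x] * D x.
Proof.
rewrite horner_coef dal_sum.
have -> : (map_poly j p)^`().[j x] = \sum_(k < size p) j p`_k * (j x ^+ k.-1 *+ k).
  rewrite -[map_poly j p]coefK poly_def raddf_sum /= horner_sum size_map_poly.
  apply: eq_bigr => k _; rewrite derivZ derivXn hornerZ hornerMn hornerXn.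
  by rewrite coef_map.
rewrite mulr_suml -big_split /=; apply: eq_bigr => k _.
by rewrite dalM rmorphXn dalX mulrA.
Qed.
End Theory.

(* The values of D on an element x separably algebraic over a field T lie in any
   T(x)-module containing D T: differentiate the equation of x. *)
Lemma deriv_sep_module (K : fieldType) (kappa : {rmorphism K -> F}) (S : F -> Prop)
    (D : F -> L) (W : L -> Prop) (T : F -> Prop) x :
  deriv_along D -> field_closed T ->
  (forall c, T (kappa c)) -> (forall s, S s -> T s) -> T x ->
  W 0 -> (forall u v, W u -> W v -> W (u + v)) -> (forall t u, T t -> W u -> W (j t * u)) ->
  (forall c, W (D (kappa c))) -> (forall s, S s -> W (D s)) ->
  sep_alg_over kappa S x -> W (D x).
Proof.
move=> HD HT TK TS Tx W0 WD WZ WK WS [p [pS [sp rx]]].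
have WN u : W u -> W (- u).
  by move=> /(WZ (-1)); rewrite rmorphN1 mulN1r; apply; apply: (fcN HT); exact: (fc1 HT).
(* The coefficients of p lie in K(S); the quotient rule carries membership of derivatives in W from
   K and S to this whole field. *)
have HS : forall y, in_genfield kappa S y -> T y /\ W (D y).
  apply: (genfield_ind (P := fun y => T y /\ W (D y))).
  - split=> [|y z [Ty Wy] [Tz Wz]|y z [Ty Wy] [Tz Wz]].
    + by rewrite (dal1 HD); split=> //; exact: (fc1 HT).
    + by rewrite (dalB HD); split; [exact: fcB|apply/WD/WN].
    + split; first exact: fc_div.
      rewrite (dal_div HD); apply: (WD).
        by rewrite mulrC -fmorphV; apply: (WZ) => //; exact: fcV.
      apply: (WN); rewrite -rmorphXn -fmorph_div; apply: (WZ) => //.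
      by apply: fc_div => //; exact: fcX.
  - by move=> c; split.
  - by move=> s Ss; split; auto.
(* A Bezout relation u p + v p' = 1 evaluated at x would read 0 = 1 if p' also vanished there. *)
have dp0 : (p^`()).[x] != 0.
  apply: contraTneq rx => d0; apply/negP => rx.
  have [u [v /= uv]] : exists u v : {poly F}, u * p + v * p^`() = 1.
    move: sp; rewrite unlock => /Bezout_eq1_coprimepP [[u v] /= e].
    by exists u, v.
  by have /eqP := congr1 (fun q => q.[x]) uv;
    rewrite !hornerE (rootP rx) d0 !mulr0 addr0 eq_sym oner_eq0.
have /eqP := dal_horner HD p x.
rewrite (rootP rx) (dal0 HD) eq_sym addr_eq0 deriv_map horner_map => /eqP e.
have -> : D x = j ((p^`()).[x])^-1 *
    (- \sum_(k < size p) D p`_k * j x ^+ k).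
  rewrite e opprK fmorphV mulrA mulVf ?mul1r //; by rewrite fmorph_eq0.
apply: (WZ).
  apply: fcV => //; rewrite horner_coef; apply: fc_sum => // k _.
  apply: fcM => //; last exact: fcX.
  rewrite coef_deriv -mulr_natl -(rmorph_nat kappa); apply: fcM => //.
  by case: (HS _ (pS k.+1)).
apply: (WN); apply: big_ind => // k _; rewrite mulrC -rmorphXn.
apply: (WZ); first exact: fcX.
by case: (HS _ (pS k)).
Qed.
End DerivationAlong.

(** G is a derivation given only as a relation, on elements whose quotients exhaust j(F). By
    additivity, being single-valued at 0 makes it single-valued, and the quotient rule extends it to
    F. *)
Lemma deriv_from_graph (F Q : fieldType) (j : {rmorphism F -> Q}) (G : Q -> Q -> Prop) :
  (forall x x' y y', G x x' -> G y y' -> G (x - y) (x' - y')) ->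
  (forall x x' y y', G x x' -> G y y' -> G (x * y) (x' * y + x * y')) ->
  (forall x', G 0 x' -> x' = 0) ->
  (forall x, exists y y' z z', [/\ G y y', G z z', z != 0 & j x = y / z]) ->
  exists D, deriv_along j D /\ forall x x', G (j x) x' -> D x = x'.
Proof.
move=> GB GM G0 Gfrac.
pose R x v := exists y y' z z',
  [/\ G y y', G z z', z != 0, j x = y / z & v = (y' - j x * z') / z].
have Rex x : exists v, R x v.
  have [y [y' [z [z' [h1 h2 h3 h4]]]]] := Gfrac x.
  by exists ((y' - j x * z') / z), y, y', z, z'.
have [D RD] := choice_fun Rex.
(* If y/z = u/t, then y t - u z = 0, so the derivative that G assigns to y t - u z is 0; this is the
   equality of the two quotient rules. *)
have Runiq x v w : R x v -> R x w -> v = w.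
  move=> [y [y' [z [z' [Gy Gz z0 e ->]]]]] [u [u' [t [t' [Gu Gt t0 e' ->]]]]].
  have ey : y = j x * z by rewrite e divfK.
  have eu : u = j x * t by rewrite e' divfK.
  have := GB _ _ _ _ (GM _ _ _ _ Gy Gt) (GM _ _ _ _ Gu Gz).
  have -> : y * t - u * z = 0 by rewrite ey eu; ring.
  move=> /G0 h; apply/eqP; rewrite -subr_eq0; apply/eqP.
  have -> : (y' - j x * z') / z - (u' - j x * t') / t =
            (y' * t + y * t' - (u' * z + u * z')) / (z * t).
    by rewrite ey eu; field; rewrite z0 t0.
  by rewrite h mul0r.
have G00 y y' : G y y' -> G 0 0 by move=> h; have := GB _ _ _ _ h h; rewrite !subrr.
have GN y y' : G y y' -> G (- y) (- y').
  by move=> h; have := GB _ _ _ _ (G00 _ _ h) h; rewrite !sub0r.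
have GD x x' y y' : G x x' -> G y y' -> G (x + y) (x' + y').
  by move=> hx /GN hy; have := GB _ _ _ _ hx hy; rewrite !opprK.
exists D; split; first split=> x1 x2.
- have [y [y' [z [z' [Gy Gz z0 e ->]]]]] := RD x1.
  have [u [u' [t [t' [Gu Gt t0 e' ->]]]]] := RD x2.
  apply: Runiq (RD _) _.
  exists (y * t + u * z), (y' * t + y * t' + (u' * z + u * z')), (z * t), (z' * t + z * t').
  split; [exact: GD (GM _ _ _ _ Gy Gt) (GM _ _ _ _ Gu Gz)|exact: GM|by rewrite mulf_neq0| |].
    by rewrite rmorphD e e'; field; rewrite z0 t0.
  have ey : y = j x1 * z by rewrite e divfK.
  have eu : u = j x2 * t by rewrite e' divfK.
  by rewrite rmorphD ey eu; field; rewrite z0 t0.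
- have [y [y' [z [z' [Gy Gz z0 e ->]]]]] := RD x1.
  have [u [u' [t [t' [Gu Gt t0 e' ->]]]]] := RD x2.
  apply: Runiq (RD _) _.
  exists (y * u), (y' * u + y * u'), (z * t), (z' * t + z * t').
  split; [exact: GM|exact: GM|by rewrite mulf_neq0| |].
    by rewrite rmorphM e e'; field; rewrite z0 t0.
  have ey : y = j x1 * z by rewrite e divfK.
  have eu : u = j x2 * t by rewrite e' divfK.
  by rewrite rmorphM ey eu; field; rewrite z0 t0.
- move=> x x' h.
  have [y [y' [z [z' [Gy Gz z0 e ->]]]]] := RD x.
  have := GB _ _ _ _ (GM _ _ _ _ h Gz) Gy.
  have ey : y = j x * z by rewrite e divfK.
  rewrite -ey subrr => /G0 /eqP; rewrite subr_eq0 => /eqP <-.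
  by field.
Qed.

Section Vanish.
Variables (K F L : fieldType) (kappa : {rmorphism K -> F}) (j : {rmorphism F -> L}).
Variables (S : F -> Prop) (D : F -> L).
Hypotheses (HD : deriv_along j D) (DK : forall c, D (kappa c) = 0)
  (DS : forall s, S s -> D s = 0).

(** The case W = 0 of [deriv_sep_module]. Applied to a difference of derivations it gives uniqueness
    of extensions, applied to a commutator it gives commutation. *)
Lemma deriv_vanish_sep x : sep_alg_over kappa S x -> D x = 0.
Proof.
pose T := (fun _ : F => True); have HT : field_closed T by [].
apply: (@deriv_sep_module _ _ j K kappa S D (fun v => v = 0) T) => //.
- by move=> u v -> ->; rewrite addr0.
- by move=> t u _ ->; rewrite mulr0.
Qed.
End Vanish.

Lemma genfield_sep_alg (K L : fieldType) (iota : {rmorphism K -> L}) (S : L -> Prop) x :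
  in_genfield iota S x -> sep_alg_over iota S x.
Proof.
move=> hx; have HC := genfield_closed iota S.
exists ('X - x%:P); split; last split; last by rewrite root_XsubC.
  move=> i; rewrite coefB coefX coefC; apply: (fcB HC).
    by case: (_ == _); [exact: (fc1 HC)|exact: (fc0 HC)].
  by case: (_ == _) => //; exact: (fc0 HC).
by rewrite unlock derivXsubC coprimep1.
Qed.

Lemma deriv_vanish_gen (K F L : fieldType) (kappa : {rmorphism K -> F})
    (j : {rmorphism F -> L}) (S : F -> Prop) (D : F -> L) :
  deriv_along j D -> (forall c, D (kappa c) = 0) -> (forall s, S s -> D s = 0) ->
  forall x, in_genfield kappa S x -> D x = 0.
Proof.
by move=> HD DK DS x /genfield_sep_alg; exact: (deriv_vanish_sep HD DK DS).
Qed.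

Lemma deriv_along_sub (F L : fieldType) (j : {rmorphism F -> L}) (D E : F -> L) :
  deriv_along j D -> deriv_along j E -> deriv_along j (fun x => D x - E x).
Proof.
by move=> HD HE; split=> x y; rewrite ?(dalD HD) ?(dalD HE) ?(dalM HD) ?(dalM HE); ring.
Qed.

Lemma deriv_agree (K F L : fieldType) (kappa : {rmorphism K -> F})
    (j : {rmorphism F -> L}) (S : F -> Prop) (D E : F -> L) :
  deriv_along j D -> deriv_along j E ->
  (forall c, D (kappa c) = E (kappa c)) -> (forall s, S s -> D s = E s) ->
  forall x, in_genfield kappa S x -> D x = E x.
Proof.
move=> HD HE DK DS x hx; apply/eqP; rewrite -subr_eq0; apply/eqP.
apply: (deriv_vanish_gen (deriv_along_sub HD HE) _ _ hx) => [c|s Ss].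
  by rewrite DK subrr.
by rewrite DS ?subrr.
Qed.

Lemma deriv_along_commutator (F : fieldType) (D E : F -> F) :
  deriv_along idfun D -> deriv_along idfun E ->
  deriv_along idfun (fun x => D (E x) - E (D x)).
Proof.
by move=> HD HE; split=> x y /=;
  rewrite ?(dalD HD, dalD HE, dalM HD, dalM HE) /= ?(dalD HD, dalD HE, dalM HD, dalM HE) /=; ring.
Qed.

Section Pullback.
Variables (K F L : fieldType) (kappa : {rmorphism K -> F}) (j : {rmorphism F -> L})
  (iota : {rmorphism K -> L}).
Hypothesis jk : forall c, j (kappa c) = iota c.

Lemma genfield_push (S : F -> Prop) y : in_genfield kappa S y ->
  in_genfield iota (fun z => exists2 s, S s & z = j s) (j y).
Proof.
have HC := genfield_closed iota (fun z => exists2 s, S s & z = j s).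
move: y; apply: (genfield_ind (P := fun y => in_genfield iota _ (j y))).
- split=> [|x y hx hy|x y hx hy]; rewrite ?rmorph1 ?rmorphB ?fmorph_div.
  + exact: (fc1 HC).
  + exact: (fcB HC).
  + exact: (fc_div HC).
- by move=> c; rewrite jk; exact: genfield_const.
- by move=> s Ss; apply: genfield_gen; exists s.
Qed.

Lemma genfield_pull (S : L -> Prop) y : (forall s, S s -> exists x, s = j x) ->
  in_genfield iota S y -> exists2 x, y = j x & in_genfield kappa (fun s => S (j s)) x.
Proof.
move=> HS; have HC := genfield_closed kappa (fun s => S (j s)).
move: y; apply: (genfield_ind (P := fun y => exists2 x, y = j x & in_genfield kappa _ x)).
- split=> [|_ _ [x -> hx] [y -> hy]|_ _ [x -> hx] [y -> hy]].
  + by exists 1; rewrite ?rmorph1 //; exact: (fc1 HC).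
  + by exists (x - y); rewrite ?rmorphB //; exact: (fcB HC).
  + by exists (x / y); rewrite ?fmorph_div //; exact: (fc_div HC).
- by move=> c; exists (kappa c); rewrite ?jk //; exact: genfield_const.
- by move=> s Ss; have [x e] := HS _ Ss; exists x => //; apply: genfield_gen; rewrite -e.
Qed.

(** The coefficients of the witness lie in j(F), so it is the image of a polynomial over F;
    separability and being a root are reflected by field embeddings. *)
Lemma sep_alg_pull (S : L -> Prop) x : (forall s, S s -> exists x, s = j x) ->
  sep_alg_over iota S (j x) -> sep_alg_over kappa (fun s => S (j s)) x.
Proof.
move=> HS [p [pS [sp rp]]].
have [q qP] : exists q : nat -> F, forall i,
    p`_i = j (q i) /\ in_genfield kappa (fun s => S (j s)) (q i).
  apply: (choice_fun (R := fun i y => p`_i = j y /\ in_genfield kappa _ y)) => i.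
  have [y e hy] := genfield_pull HS (pS i).
  by exists y.
have ep : p = map_poly j (\poly_(i < size p) q i).
  apply/polyP => i; rewrite coef_map coef_poly.
  by case: ltnP => h; [case: (qP i)|rewrite nth_default // (raddf0 j)].
have HC := genfield_closed kappa (fun s => S (j s)).
exists (\poly_(i < size p) q i); split; last split.
- by move=> i; rewrite coef_poly; case: ltnP => _; [case: (qP i)|exact: (fc0 HC)].
- by rewrite -(separable_map j) -ep.
- by rewrite -(fmorph_root j) -ep.
Qed.

Lemma sep_alg_push (S : F -> Prop) x :
  sep_alg_over kappa S x -> sep_alg_over iota (fun z => exists2 s, S s & z = j s) (j x).
Proof.
move=> [p [pS [sp rp]]]; exists (map_poly j p); split; last split.
- by move=> i; rewrite coef_map; exact: genfield_push.
- by rewrite separable_map.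
- by rewrite fmorph_root.
Qed.

End Pullback.

Lemma sep_alg_weaken (K L : fieldType) (iota : {rmorphism K -> L}) (S S' : L -> Prop) x :
  (forall s, S s -> in_genfield iota S' s) ->
  sep_alg_over iota S x -> sep_alg_over iota S' x.
Proof.
move=> H [p [pS h]]; exists p; split=> // i; exact: genfield_sub (pS i).
Qed.

(** * Transcendental extensions *)

Lemma fraction_repr (R : idomainType) (x : {fraction R}) :
  exists p q : R, q != 0 /\ x = tofrac p / tofrac q.
Proof.
elim/quotW: x => x; exists \n_x, \d_x; split; first exact: denom_ratioP.
have d0 : tofrac \d_x != 0 by rewrite tofrac_eq0 denom_ratioP.
apply: (canRL (mulfK d0)); unlock tofrac; rewrite -[LHS]FracField.pi_mul.
apply/eqmodP; rewrite /= /FracField.equivf /FracField.mulf.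
by rewrite !numden_Ratio ?oner_eq0 ?mulr1 ?denom_ratioP //= mulrC.
Qed.

(* An abstract fraction field: computing in the concrete one makes unification diverge. *)
Lemma fraction_field (R : idomainType) :
  exists (Q : fieldType) (emb : {rmorphism R -> Q}),
    (forall p, emb p = 0 -> p = 0) /\
    (forall x, exists p q, q != 0 /\ x = emb p / emb q).
Proof.
exists {fraction R}, (@tofrac R); split; last exact: fraction_repr.
by move=> p /eqP; rewrite tofrac_eq0 => /eqP.
Qed.

Module InfiniteVariables.
Import finmap monalg.

Section Domain.
Variables (F : fieldType) (I : choiceType).
Notation A := {malg F[{cmonom I}]}.

Section Finite.
Variable (s : seq I).
Let N := size s.
Definition restr (k : {cmonom I}) : mpoly.multinom N :=
  mpoly.Multinom [tuple k (tnth (in_tuple s) i) | i < N].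

Lemma restrE k i : restr k i = k (tnth (in_tuple s) i).
Proof. by rewrite mpoly.multinomE tnth_mktuple. Qed.

Definition restrX (k : {cmonom I}) : mpoly.mpoly N F := mpoly.mpolyX F (restr k).

Lemma restrX_mmorphism : mmorphism restrX.
Proof.
split=> [k l|]; rewrite /restrX.
  rewrite -mpoly.mpolyXD; congr mpoly.mpolyX; apply/mpoly.mnmP => i.
  by rewrite mpoly.mnmDE !restrE cmM.
rewrite -mpoly.mpolyX0; congr mpoly.mpolyX; apply/mpoly.mnmP => i.
by rewrite mpoly.mnm0E restrE cm1.
Qed.
HB.instance Definition _ := isMultiplicative.Build _ _ restrX restrX_mmorphism.

Definition restr_poly : A -> mpoly.mpoly N F := mmap (@mpoly.mpolyC N F) restrX.
Lemma restr_polyM p q : restr_poly (p * q) = restr_poly p * restr_poly q.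
Proof. exact: rmorphM. Qed.

Definition supported (k : {cmonom I}) := forall i, i \notin s -> k i = 0%N.

Lemma restr_inj k l : supported k -> supported l -> restr k = restr l -> k = l.
Proof.
move=> hk hl /mpoly.mnmP e; apply/eqP/cmP => i.
have [|ni] := boolP (i \in s); last by rewrite hk ?hl.
move=> /(nthP i) [n ln <-].
by have := e (Ordinal ln); rewrite !restrE !(tnth_nth i).
Qed.

Lemma restr_poly_eq0 (p : A) : (forall k, k \in msupp p -> supported k) ->
  restr_poly p = 0 -> p = 0.
Proof.
move=> hp e; apply/eqP; rewrite -msupp_eq0; apply/eqP/fsetP => k; rewrite in_fset0.
apply/negP => hk; move: (hk); rewrite -mcoeff_neq0 => /negP; apply; apply/eqP.
have := congr1 (mpoly.mcoeff (restr k)) e.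
rewrite mpoly.mcoeff0 /restr_poly mmapE raddf_sum /=.
rewrite (bigD1_seq k) ?fset_uniq //= mpoly.mcoeffCM mpoly.mcoeffX eqxx mulr1 big_seq_cond.
rewrite big1 ?addr0 // => l /andP [hl nl].
rewrite mpoly.mcoeffCM mpoly.mcoeffX; case: eqP => [h|]; last by rewrite mulr0.
by rewrite (restr_inj (hp _ hl) (hp _ hk) h) eqxx in nl.
Qed.
End Finite.

(** Only the finitely many variables in [s] occur in p and q. Restriction to them is multiplicative,
    lands in a polynomial ring in finitely many variables, which is a domain, and kills neither p
    nor q unless they are 0. *)
Lemma malg_integral (p q : A) : p * q = 0 -> (p == 0) || (q == 0).
Proof.
move=> pq0.
pose s := flatten [seq (finsupp k : seq I) | k : {cmonom I} <- (msupp p `|` msupp q)%fset].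
have hs g k : {subset msupp g <= (msupp p `|` msupp q)%fset} -> k \in msupp g -> supported s k.
  move=> hg /hg hk i ni; apply/eqP; rewrite cmE_eq0; apply: contra ni => hi.
  by apply/flattenP; exists (finsupp k : seq I) => //; apply/mapP; exists k.
have := restr_polyM s p q; rewrite pq0 {1}/restr_poly raddf0 => /esym /eqP.
rewrite mulf_eq0 => /orP [] /eqP h; apply/orP; [left|right]; apply/eqP;
  apply: restr_poly_eq0 h => k; apply: hs => l hl; by rewrite in_fsetU hl ?orbT.
Qed.

(** An alias to which the integral domain structure is attached; its units and inverses are obtained
    classically. *)
Definition polyring := A.
HB.instance Definition _ := GRing.ComNzRing.on polyring.

Definition poly_unit : {pred polyring} := [pred x | asb (exists y, y * x = 1)].
Definition poly_inv (x : polyring) : polyring :=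
  if excluded_middle_informative (exists y, y * x = 1) is left h
  then proj1_sig (constructive_indefinite_description _ h) else x.

Lemma poly_mulVx : {in poly_unit, left_inverse 1 poly_inv *%R}.
Proof.
move=> x /asbP h; rewrite /poly_inv.
by case: excluded_middle_informative => // h'; case: constructive_indefinite_description.
Qed.
Lemma poly_unitPl (x y : polyring) : y * x = 1 -> x \in poly_unit.
Proof. by move=> h; apply/asbP; exists y. Qed.
Lemma poly_inv_out : {in [predC poly_unit], poly_inv =1 id}.
Proof.
move=> x /negP h; rewrite /poly_inv.
by case: excluded_middle_informative => // h'; case: h; apply/asbP.
Qed.
HB.instance Definition _ :=
  GRing.ComNzRing_hasMulInverse.Build polyring poly_mulVx poly_unitPl poly_inv_out.
HB.instance Definition _ := GRing.ComUnitRing_isIntegral.Build polyring malg_integral.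
End Domain.

Section Derivation.
Variables (F : fieldType) (I : choiceType).
Notation A := (polyring F I).
Variables (Q : fieldType) (emb : {rmorphism A -> Q}).
Hypothesis emb_inj : forall p, emb p = 0 -> p = 0.
Hypothesis emb_frac : forall x, exists p q, q != 0 /\ x = emb p / emb q.

Definition aconst (c : F) : A := << c *g mone >>.
Lemma aconst_zmod : zmod_morphism aconst.
Proof. exact: (raddfB (@malgC {cmonom I} F)). Qed.
Lemma aconst_monoid : monoid_morphism aconst.
Proof. by split=> [//|]; exact: (rmorphM (@malgC {cmonom I} F)). Qed.
HB.instance Definition _ := GRing.isZmodMorphism.Build F A aconst aconst_zmod.
HB.instance Definition _ := GRing.isMonoidMorphism.Build F A aconst aconst_monoid.

Definition fconst : {rmorphism F -> Q} := GRing.RMorphism.clone _ _ (emb \o aconst) _.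
Definition fmono (k : {cmonom I}) : Q := emb (<< k >> : A).
Definition fvar (i : I) : Q := fmono (ucm i).

Lemma fmonoM k l : fmono (mmul k l) = fmono k * fmono l.
Proof.
rewrite /fmono /= -rmorphM; congr (emb _).
by rewrite -[RHS]/((<< k >> : {malg F[{cmonom I}]}) * << l >>) malgM_def fgmulUU mulr1.
Qed.

Lemma fmono1 : fmono mone = 1. Proof. exact: (rmorph1 emb). Qed.

Lemma fvar_neq0 i : fvar i != 0.
Proof.
apply/eqP => /emb_inj h.
have : (<< 1 *g ucm i >> : {malg F[{cmonom I}]}) == 0 by apply/eqP.
by rewrite monalgU_eq0 oner_eq0.
Qed.

Lemma emb_malgE (p : A) : emb p = \sum_(k <- msupp p) fconst (mcoeff k p) * fmono k.
Proof.
rewrite {1}(monalgE p) rmorph_sum /=; apply: eq_bigr => k _.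
rewrite /fmono /= -rmorphM; congr (emb _).
by rewrite -[RHS]/((<< mcoeff k p *g mone >> : {malg F[{cmonom I}]}) * << k >>)
  malgM_def fgmulUU mul1m mulr1.
Qed.

Lemma fraction_generated (x : Q) : in_genfield fconst (fun y => exists i, y = fvar i) x.
Proof.
have HC := genfield_closed fconst (fun y => exists i, y = fvar i).
suff h p : in_genfield fconst (fun y => exists i, y = fvar i) (emb p).
  by have [p [q [_ ->]]] := emb_frac x; exact: (fc_div HC).
rewrite emb_malgE; apply: (fc_sum HC) => k _; apply: (fcM HC).
  exact: genfield_const.
have [n] := ubnP (mdeg k); elim: n k => // n IH k hn.
have [->|k1] := eqVneq k mone; first by rewrite fmono1; exact: (fc1 HC).
have [i hi] : exists i, k i != 0%N.
  apply/not_all_not_ex => h; case/negP: k1; apply/cmP => i; rewrite cm1.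
  by apply/eqP/negPn/negP/h.
have ek : k = mmul (ucm i) (divcm k (ucm i)).
  apply/eqP/cmP => l; rewrite cmM divcmE cmU.
  by case: eqP => [<-|_]; rewrite ?add0n ?subn0 // subnKC // lt0n.
rewrite ek fmonoM; apply: (fcM HC).
  by apply: genfield_gen; exists i.
by apply: IH; move: hn; rewrite {1}ek mdegM mdegU.
Qed.

(** The Leibniz rule for the terms c x and e y, where [lx] and [ly] are the logarithmic derivatives
    of the monomials x and y. *)
Lemma leibniz_log (R : comPzRingType) (dc c de e x y lx ly : R) :
  (dc * e + c * de) * (x * y) + c * e * (x * y * (lx + ly)) =
  (dc * x + c * (x * lx)) * (e * y) + c * x * (de * y + e * (y * ly)).
Proof. by ring. Qed.

Section Extension.
Variables (delta : F -> Q) (u : I -> Q).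
Hypothesis Hdelta : deriv_along fconst delta.

(** The logarithmic derivative of the monomial k when the variable i has derivative [u i]. It turns
    products of monomials into sums and avoids exponents k i - 1. *)
Definition logd (k : {cmonom I}) : Q := \sum_(i <- finsupp k) (u i / fvar i) *+ k i.

Lemma logd_w (k : {cmonom I}) (d : {fset I}) : (finsupp k `<=` d)%fset ->
  logd k = \sum_(i <- d) (u i / fvar i) *+ k i.
Proof.
move=> le; rewrite /logd (big_fset_incl _ le) //.
by move=> i _; rewrite -cmE_neq0 negbK => /eqP ->.
Qed.

Lemma logdM k l : logd (mmul k l) = logd k + logd l.
Proof.
rewrite {1}/logd mdomD (logd_w (fsubsetUl _ (finsupp l))) (logd_w (fsubsetUr (finsupp k) _)).
by rewrite -big_split /=; apply: eq_bigr => i _; rewrite cmM mulrnDr.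
Qed.

Definition dterm_at (c : F) (k : {cmonom I}) : Q :=
  delta c * fmono k + fconst c * (fmono k * logd k).

Definition dpoly (p : A) : Q := \sum_(k <- msupp p) dterm_at (mcoeff k p) k.

Lemma dpoly_w (p : A) (d : {fset {cmonom I}}) : (msupp p `<=` d)%fset ->
  dpoly p = \sum_(k <- d) dterm_at (mcoeff k p) k.
Proof.
move=> le; rewrite /dpoly (big_fset_incl _ le) //.
move=> k _ /mcoeff_outdom ->.
by rewrite /dterm_at (dal0 Hdelta) rmorph0 !mul0r addr0.
Qed.

Lemma dpolyD p q : dpoly (p + q) = dpoly p + dpoly q.
Proof.
pose d := (msupp (p + q) `|` (msupp p `|` msupp q))%fset.
have h1 : (msupp (p + q) `<=` d)%fset by exact: fsubsetUl.
have h2 : (msupp p `<=` d)%fset by exact: fsubset_trans (fsubsetUl _ _) (fsubsetUr _ _).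
have h3 : (msupp q `<=` d)%fset by exact: fsubset_trans (fsubsetUr _ _) (fsubsetUr _ _).
rewrite (dpoly_w h1) (dpoly_w h2) (dpoly_w h3) -big_split; apply: eq_bigr => k _ /=.
rewrite (_ : mcoeff k (p + q) = mcoeff k p + mcoeff k q); last exact: mcoeffD.
by rewrite /dterm_at (dalD Hdelta) rmorphD !mulrDl addrACA.
Qed.

Lemma dpoly0 : dpoly 0 = 0.
Proof. by apply: (addrI (dpoly 0)); rewrite -dpolyD !addr0. Qed.

Lemma dpolyU c k : dpoly (<< c *g k >> : A) = dterm_at c k.
Proof. by rewrite (dpoly_w msuppU_le) big_seq_fset1 mcoeffUU. Qed.

Lemma dpolyM p q : dpoly (p * q) = dpoly p * emb q + emb p * dpoly q.
Proof.
have -> : dpoly (p * q) = \sum_(k <- msupp p) \sum_(l <- msupp q)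
    dterm_at (mcoeff k p * mcoeff l q) (mmul k l).
  rewrite (_ : p * q = \sum_(k <- msupp p) \sum_(l <- msupp q)
    (<< mcoeff k p * mcoeff l q *g mmul k l >> : A)); last exact: malgME.
  rewrite (big_morph dpoly dpolyD dpoly0); apply: eq_bigr => k _.
  by rewrite (big_morph dpoly dpolyD dpoly0); apply: eq_bigr => l _; rewrite dpolyU.
rewrite !emb_malgE /dpoly !mulr_suml -big_split /=; apply: eq_bigr => k _.
rewrite !mulr_sumr -big_split /=; apply: eq_bigr => l _.
by rewrite /dterm_at (dalM Hdelta) fmonoM logdM (rmorphM fconst); exact: leibniz_log.
Qed.

(** On polynomials [dpoly] is the required derivation; its graph satisfies the conditions of
    [deriv_from_graph], which passes to fractions. *)
Lemma deriv_extension : exists D : Q -> Q, [/\ deriv_along idfun D,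
  forall c, D (fconst c) = delta c & forall i, D (fvar i) = u i].
Proof.
pose G x x' := exists2 p, x = emb p & x' = dpoly p.
have dN p : dpoly (- p) = - dpoly p.
  by apply: (addrI (dpoly p)); rewrite -dpolyD !subrr dpoly0.
have [||x' [p /esym]|x|D [HD DG]] := @deriv_from_graph Q Q idfun G.
- move=> _ _ _ _ [p -> ->] [q -> ->]; exists (p - q); first by rewrite rmorphB.
  by rewrite dpolyD dN.
- move=> _ _ _ _ [p -> ->] [q -> ->]; exists (p * q); first by rewrite rmorphM.
  by rewrite dpolyM.
- by move=> /emb_inj -> ->; exact: dpoly0.
- have [p [q [q0 ->]]] := emb_frac x.
  exists (emb p), (dpoly p), (emb q), (dpoly q); split=> //.
  + by exists p.
  + by exists q.
  + by apply: contraNneq q0 => /emb_inj ->.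
exists D; split=> // [c|i].
  rewrite (DG _ (dpoly (<< c *g mone >> : A))); last by exists (<< c *g mone >> : A).
  rewrite dpolyU /dterm_at /logd mdom1 big_seq_fset0 fmono1.
  by rewrite !mulr0 addr0 mulr1.
rewrite (DG _ (dpoly (<< ucm i >> : A))); last by exists (<< ucm i >> : A).
rewrite dpolyU /dterm_at (dal1 Hdelta) /logd mdomU big_seq_fset1 cmUU.
by rewrite (rmorph1 fconst) mul0r add0r mul1r mulr1n mulrC divfK // fvar_neq0.
Qed.
End Extension.
End Derivation.


(** The algebraic independence of the t i enters the later arguments only as the freedom to
    prescribe their derivatives. *)
Lemma transcendental_extension (F : fieldType) (I : choiceType) :
  exists (Q : fieldType) (e : {rmorphism F -> Q}) (t : I -> Q),
    (forall x, in_genfield e (fun y => exists i, y = t i) x) /\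
    (forall (delta : F -> Q) (u : I -> Q), deriv_along e delta ->
      exists D : Q -> Q, [/\ deriv_along idfun D,
        forall c, D (e c) = delta c & forall i, D (t i) = u i]).
Proof.
have [Q [emb [emb_inj emb_frac]]] := fraction_field (polyring F I).
exists Q, (fconst emb), (fvar emb); split.
- exact: fraction_generated.
- by move=> delta u; exact: deriv_extension.
Qed.
End InfiniteVariables.

(** * The order of the generators, Dickson's lemma and the basis theorem *)

Lemma lexle_refl s : lexle s s.
Proof. by elim: s => //= x s ->; rewrite eqxx orbT. Qed.

Lemma lexle_anti s t : lexle s t -> lexle t s -> s = t.
Proof.
elim: s t => [|x s IH] [|y t] //=.
case: (ltngtP x y) => //= -> hs ht; by rewrite (IH t).
Qed.

Lemma lexle_trans t s u : lexle s t -> lexle t u -> lexle s u.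
Proof.
elim: s t u => [|x s IH] [|y t] [|z u] //=.
move=> /orP [hxy|/andP [/eqP <- hst]] /orP [hyz|/andP [/eqP <- htu]].
- by rewrite (ltn_trans hxy hyz).
- by rewrite hxy.
- by rewrite hyz.
- by rewrite eqxx (IH _ _ hst htu) orbT.
Qed.

Lemma lexle_total s t : lexle s t || lexle t s.
Proof.
elim: s t => [|x s IH] [|y t] //=.
by case: (ltngtP x y) => //= _; exact: IH.
Qed.

Lemma lexle_add (A : eqType) (f g e : A -> nat) (s : seq A) :
  lexle (map f s) (map g s) ->
  lexle [seq (f i + e i)%N | i <- s] [seq (g i + e i)%N | i <- s].
Proof.
elim: s => //= x s IH; rewrite ltn_add2r eqn_add2r.
by move=> /orP [->//|/andP [-> /IH ->]]; rewrite orbT.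
Qed.

(** Without equal lengths there are infinite descents such as [1], [0,1], [0,0,1], and so on. *)
Definition lexlt s t := [/\ size s = size t, lexle s t & s <> t].

Lemma lexlt_wf : well_founded lexlt.
Proof.
move=> s; have [n] : exists n, size s = n by exists (size s).
elim: n s => [|n IH] s hs.
  by rewrite (size0nil hs); constructor=> -[|y t] [] // _ _ [].
case: s hs => [|x s] hs; first by discriminate hs.
move: hs => /succn_inj hs.
(* Nested inductions: on the length, then on the head, then on the accessibility of the tail. *)
elim/ltn_ind: x s hs => x IHx s hs.
have acc_s := IH s hs; elim: acc_s hs => {}s _ IHs hs.
constructor=> -[|y t] [e h ne]; first discriminate e.
have {}e : size t = size s by case: e.
move: h => /= /orP [hyx|/andP [/eqP eyx ht]].
  apply: (IHx y hyx t); exact: etrans e hs.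
rewrite eyx; apply: (IHs t); last exact: etrans e hs.
by split=> // ets; apply: ne; rewrite eyx ets.
Qed.

Section Index.
Variables (m n : nat).
Notation J := ('X_{1..m} * 'I_n)%type.
Implicit Types (v w : J) (i : 'I_m).

Definition jkey (v : J) : seq nat :=
  mdeg v.1 :: (v.2 : nat) :: take m.-1 [seq v.1 i | i <- enum 'I_m].
Definition jle v w := lexle (jkey v) (jkey w).
Definition jlt v w := jle v w && (v != w).
Definition jshift i (v : J) : J := ((v.1 + U_(i))%MM, v.2).

Lemma mdeg_sumn (x : 'X_{1..m}) : mdeg x = sumn [seq x i | i <- enum 'I_m].
Proof. by rewrite mdegE sumnE big_map big_enum. Qed.

(** The key omits the last exponent, which is recovered from the total degree. *)
Lemma jkey_inj : injective jkey.
Proof.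
move=> [x k] [y l] [] ed ek et.
suff e : [seq x i | i <- enum 'I_m] = [seq y i | i <- enum 'I_m].
  congr (_, _); last exact: val_inj.
  by apply/mnmP => i; apply: (eq_in_map _ _ _).2 e i (mem_enum _ _).
move: ed et; rewrite !mdeg_sumn.
set s := [seq x i | i <- _]; set t := [seq y i | i <- _].
have ss : size s = m by rewrite size_map size_enum_ord.
have st : size t = m by rewrite size_map size_enum_ord.
move=> es et; rewrite -(cat_take_drop m.-1 s) -(cat_take_drop m.-1 t) et; congr (_ ++ _).
have : sumn (drop m.-1 s) = sumn (drop m.-1 t).
  by apply: (@addnI (sumn (take m.-1 s))); rewrite {2}et -!sumn_cat !cat_take_drop.
have : size (drop m.-1 s) = size (drop m.-1 t) by rewrite !size_drop ss st.
have : (size (drop m.-1 s) <= 1)%N by rewrite size_drop ss; lia.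
move: (drop m.-1 s) (drop m.-1 t) => [|a [|? ?]] [|b [|? ?]] //= _ _.
by rewrite !addn0 => ->.
Qed.

Lemma jle_refl v : jle v v. Proof. exact: lexle_refl. Qed.
Lemma jle_trans w v u : jle v w -> jle w u -> jle v u.
Proof. exact: lexle_trans. Qed.
Lemma jle_anti v w : jle v w -> jle w v -> v = w.
Proof. by move=> h1 h2; apply/jkey_inj/lexle_anti. Qed.
Lemma jltW v w : jlt v w -> jle v w. Proof. by case/andP. Qed.
Lemma jle_lt_trans w v u : jle v w -> jlt w u -> jlt v u.
Proof.
move=> h1 /andP [h2 ne]; rewrite /jlt (jle_trans h1 h2) /=.
by apply: contra ne => /eqP e; subst u; rewrite (jle_anti h1 h2).
Qed.
Lemma jlt_trans w v u : jlt v w -> jlt w u -> jlt v u.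
Proof. by move=> /jltW; exact: jle_lt_trans. Qed.
Lemma jle_eqVlt v w : jle v w = (v == w) || jlt v w.
Proof. by rewrite /jlt; case: eqP => [->|_]; rewrite ?jle_refl ?andbT. Qed.
Lemma jltNge v w : jlt v w = ~~ jle w v.
Proof.
apply/idP/idP => [/andP [h ne]|h].
  by apply: contra ne => h'; rewrite (jle_anti h h').
have := lexle_total (jkey v) (jkey w); rewrite -/(jle v w) -/(jle w v) (negbTE h) orbF => h'.
by rewrite /jlt h'; apply: contra h => /eqP ->; exact: jle_refl.
Qed.

Lemma jle_mdeg v w : jle v w -> (mdeg v.1 <= mdeg w.1)%N.
Proof. by move=> /= /orP [/ltnW //|/andP [/eqP ->]]. Qed.

Lemma jlt_mdeg v w : (mdeg v.1 < mdeg w.1)%N -> jlt v w.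
Proof. by move=> h; rewrite jltNge; apply/negP => /jle_mdeg; rewrite leqNgt h. Qed.

Lemma mdeg_jshift i v : mdeg (jshift i v).1 = (mdeg v.1).+1.
Proof. by rewrite mdegD mdeg1 addn1. Qed.

Lemma jlt_shift i v : jlt v (jshift i v).
Proof. by apply: jlt_mdeg; rewrite mdeg_jshift. Qed.

Lemma jshift_inj i : injective (jshift i).
Proof.
move=> [x k] [y l] e.
have /addIm -> : (x + U_(i))%MM = (y + U_(i))%MM := congr1 fst e.
by have -> : k = l := congr1 snd e.
Qed.

Lemma jle_shift2 i v w : jle v w -> jle (jshift i v) (jshift i w).
Proof.
rewrite /jle /jkey !mdeg_jshift /= ltnS eqSS => /orP [->//|/andP [-> /=]].
move=> /orP [->|/andP [-> /= h]]; first by rewrite orbT.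
apply/orP; right; apply/orP; right; move: h; rewrite -!map_take => /(lexle_add (fun l => U_(i)%MM l)).
by under eq_map do rewrite -mnmDE; under [X in lexle _ X]eq_map do rewrite -mnmDE.
Qed.

Lemma jlt_shift2 i v w : jlt v w -> jlt (jshift i v) (jshift i w).
Proof.
by move=> /andP [h ne]; rewrite /jlt jle_shift2 //= (inj_eq (@jshift_inj i)).
Qed.

Lemma jlt_ind (P : J -> Prop) : (forall v, (forall w, jlt w v -> P w) -> P v) -> forall v, P v.
Proof.
move=> H v; elim: (wf_inverse_image _ _ _ jkey lexlt_wf v) => {}v _ IH.
apply: H => w /andP [h ne]; apply: IH; split=> //.
  by rewrite /= !size_take !size_map.
by move=> /jkey_inj e; rewrite e eqxx in ne.
Qed.
End Index.

(** Induction on the length. Take a finite basis B' of the tails, give each t in B' a head f t, and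
    let N be the largest of these. A sequence with head at least N lies above some f t :: t; for
    each of the finitely many heads below N the induction hypothesis applies to the tails. *)
Lemma dickson_seq m (P : seq nat -> Prop) : (forall s, P s -> size s = m) ->
  exists B : seq (seq nat), (forall s, s \in B -> P s) /\
    forall s, P s -> exists2 t, t \in B & all2 leq t s.
Proof.
elim: m P => [|m IH] P hP.
  have [P0|nP0] := classic (P [::]).
    by exists [:: [::]]; split=> [s|s /hP /size0nil ->];
      [rewrite inE => /eqP ->|exists [::]].
  by exists [::]; split=> // s Ps; case: nP0; rewrite -(size0nil (hP _ Ps)).
have [|B' [B'P hB']] := IH (fun t => exists x, P (x :: t)).
  by move=> t [x /hP []].
have [f fP] : exists f : seq nat -> nat, forall t, (exists x, P (x :: t)) -> P (f t :: t).
  apply: (choice_fun (R := fun t x => (exists x, P (x :: t)) -> P (x :: t))) => t.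
  by have [[x hx]|h] := classic (exists x, P (x :: t)); [exists x|exists 0%N].
pose N := \max_(t <- B') f t.
have [g gP] : exists g : nat -> seq (seq nat), forall x,
    (forall t, t \in g x -> P (x :: t)) /\
    forall t, P (x :: t) -> exists2 u, u \in g x & all2 leq u t.
  apply: (choice_fun (R := fun x B => (forall t, t \in B -> P (x :: t)) /\
    forall t, P (x :: t) -> exists2 u, u \in B & all2 leq u t)) => x.
  by apply: IH => t /hP [].
exists ([seq f t :: t | t <- B'] ++ [seq x :: t | x <- iota 0 N, t <- g x]); split.
  move=> s; rewrite mem_cat => /orP [/mapP [t /B'P ht ->]|]; first exact: fP.
  by move=> /allpairsPdep [x [t [_ ht ->]]]; case: (gP x) => h _; exact: h.
move=> [|x s] Ps; first by have := hP _ Ps.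
have [hx|hx] := ltnP x N.
  have [t ht hts] := (gP x).2 _ Ps.
  exists (x :: t); last by rewrite /= leqnn.
  rewrite mem_cat; apply/orP; right; apply/allpairsPdep.
  by exists x, t; rewrite mem_iota.
have [t ht hts] := hB' s (ex_intro _ x Ps).
exists (f t :: t); first by rewrite mem_cat map_f.
rewrite /= hts andbT; apply: leq_trans hx.
by rewrite /N (big_rem t) //= leq_maxl.
Qed.

Lemma dickson m (P : 'X_{1..m} -> Prop) :
  exists B : seq 'X_{1..m}, (forall x, x \in B -> P x) /\
    forall x, P x -> exists2 y, y \in B & (y <= x)%MM.
Proof.
have [|B [BP hB]] := @dickson_seq m (fun s => exists2 x : 'X_{1..m}, P x & s = x :> seq nat).
  by move=> _ [x _ ->]; rewrite size_tuple.
have [f fP] : exists f : seq nat -> 'X_{1..m}, forall s, s \in B -> P (f s) /\ s = f s :> seq nat.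
  apply: (choice_fun (R := fun s (x : 'X_{1..m}) => s \in B -> P x /\ s = x :> seq nat)) => s.
  have [/BP [x Px e]|h] := boolP (s \in B); first by exists x.
  by exists 0%MM.
exists (map f B); split=> [x /mapP [s /fP [h _] ->] //|x Px].
have [t ht le] := hB x (ex_intro2 _ _ x Px erefl).
exists (f t); first exact: map_f.
have [_ e] := fP _ ht; apply/mnm_lepP => i.
rewrite !(mnm_nth 0%N) -e; move: le; rewrite all2E => /andP [/eqP es /(all_nthP (0, 0)%N) h].
have := h i; rewrite size_zip es minnn size_tuple nth_zip //=; apply; exact: ltn_ord.
Qed.

(** Dickson's lemma for the leading monomials of I gives B, and division by B lowers the leading
    monomial. Generation is expressed by quantifying over all ideals Z containing B, so no cofactors
    need to be recorded. *)
Lemma hilbert_basis (K : fieldType) N (I : {mpoly K[N]} -> Prop) :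
  (forall f g, I f -> I g -> I (f - g)) -> (forall f g, I g -> I (f * g)) ->
  exists B : seq {mpoly K[N]}, (forall g, g \in B -> I g) /\
    forall Z : {mpoly K[N]} -> Prop, Z 0 -> (forall f g, Z f -> Z g -> Z (f + g)) ->
      (forall f g, Z g -> Z (f * g)) -> (forall g, g \in B -> Z g) -> forall f, I f -> Z f.
Proof.
move=> IB IM; pose P x := exists f, [/\ I f, f != 0 & mlead f = x].
have [B [BP hB]] := dickson P.
have [F FP] : exists F : 'X_{1..N} -> {mpoly K[N]}, forall x, x \in B ->
    [/\ I (F x), F x != 0 & mlead (F x) = x].
  apply: (choice_fun (R := fun x f => x \in B -> [/\ I f, f != 0 & mlead f = x])) => x.
  have [/BP [f hf]|_] := boolP (x \in B); first by exists f.
  by exists 0.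
exists (map F B); split=> [g /mapP [x /FP [h _ _] ->] //|Z Z0 ZD ZM ZB f].
have [x] : exists x, mlead f = x by exists (mlead f).
elim/(well_founded_induction (@ltom_wf N)): x f => x IH f ef If.
have [->//|f0] := eqVneq f 0.
have [y hy] := hB _ (ex_intro _ f (And3 If f0 ef)).
have [Ig g0 eg] := FP _ hy; set g := F y in Ig g0 eg; move=> le_yx.
(* The multiple h g has the same leading term as f. *)
pose h : {mpoly K[N]} := (mleadc f / mleadc g) *: 'X_[x - y].
have lf : mleadc f != 0 by rewrite mleadc_eq0.
have lg : mleadc g != 0 by rewrite mleadc_eq0.
have h0 : h != 0.
  by apply/eqP => /(congr1 (mcoeff (x - y)%MM)) /eqP;
    rewrite mcoeffZ mcoeffX eqxx mulr1 mcoeff0 mulf_eq0 invr_eq0 (negbTE lf) (negbTE lg).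
have eh : mlead h = (x - y)%MM by rewrite mleadZ ?mleadXm // mulf_neq0 ?invr_neq0.
have ehg : mlead (h * g) = x by rewrite mleadM // eh eg submK.
have -> : f = (f - h * g) + h * g by rewrite subrK.
apply: ZD; last by apply/ZM/ZB/map_f.
have [->//|d0] := eqVneq (f - h * g) 0.
apply: (IH (mlead (f - h * g))) => //; last by apply: IB => //; exact: IM.
have le : (mlead (f - h * g) <= x)%O.
  by apply: le_trans (mleadB_le _ _) _; rewrite ef ehg joinxx.
rewrite lt_neqAle le andbT; apply: contraNneq d0 => e.
rewrite -mleadc_eq0 e mcoeffB subr_eq0 -{1}ef.
have -> : (h * g)@_x = mleadc h * mleadc g by rewrite -mleadcM -mleadM // ehg.
by rewrite eh mcoeffZ mcoeffX eqxx mulr1 divfK.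
Qed.

(** * Polynomials in the generators *)

Section Reindex.
Variables (m r n : nat).
Notation J := ('X_{1..m} * 'I_n)%type.
Implicit Types (v s : Idx m r n) (w : J).

Definition idx_to_j v : J := ([multinom (v.1 i : nat) | i < m], v.2).
Definition j_to_idx w : Idx m r n := ([ffun i => inord (w.1 i)], w.2).

Lemma idx_to_jK : cancel idx_to_j j_to_idx.
Proof.
move=> [x k]; congr (_, _); apply/ffunP => i; rewrite ffunE mnmE.
by rewrite inord_val.
Qed.

Lemma j_to_idxK w : (mdeg w.1 <= 2 * r)%N -> idx_to_j (j_to_idx w) = w.
Proof.
case: w => x k /= h; congr (_, _); apply/mnmP => i; rewrite mnmE ffunE inordK // ltnS.
by apply: leq_trans h; rewrite mdegE (bigD1 i) //= leq_addr.
Qed.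

Lemma mdeg_idx v : mdeg (idx_to_j v).1 = absx v.1.
Proof. by rewrite mdegE; apply: eq_bigr => i _; rewrite mnmE. Qed.

Lemma ileE v s : ile v s = jle (idx_to_j v) (idx_to_j s).
Proof.
rewrite /ile /jle; congr lexle; rewrite /idx_key /jkey mdeg_idx; congr [:: _, _ & take _ _];
  by apply: eq_map => i; rewrite mnmE.
Qed.

Lemma iltE v s : ilt v s = jlt (idx_to_j v) (idx_to_j s).
Proof. by rewrite /ilt /jlt ileE (inj_eq (can_inj idx_to_jK)). Qed.

Lemma idx_shift i v : (absx v.1 < 2 * r)%N -> idx_to_j (ishift i v) = jshift i (idx_to_j v).
Proof.
move=> h; congr (_, _); apply/mnmP => l; rewrite mnmE ffunE mnmDE mnm1E mnmE inordK // ltnS.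
have : (v.1 l <= absx v.1)%N by rewrite /absx (bigD1 l) //= leq_addr.
by case: (i == l); lia.
Qed.

Lemma absx_shift i v : (absx v.1 < 2 * r)%N -> absx (ishift i v).1 = (absx v.1).+1.
Proof. by move=> h; rewrite -!mdeg_idx idx_shift // mdeg_jshift. Qed.

Definition jlead (K L : fieldType) (iota : {rmorphism K -> L}) (a : J -> L) w :=
  sep_alg_over iota (fun y => exists2 v, jlt v w & y = a v) (a w).

(** Everything below s has order at most that of s, hence at most 2r, where the bounded and the
    unbounded indexing agree; the junk indices do not interfere. *)
Lemma sep_leaderE (K L : fieldType) (iota : {rmorphism K -> L}) (a : Idx m r n -> L)
    (aJ : J -> L) s : (forall v, (absx v.1 <= 2 * r)%N -> a v = aJ (idx_to_j v)) ->
  (absx s.1 <= 2 * r)%N -> sep_leader iota a s <-> jlead iota aJ (idx_to_j s).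
Proof.
move=> ha hs; rewrite /sep_leader /jlead ha //.
split; apply: sep_alg_weaken => y.
  move=> [v [hv ->]]; apply: genfield_gen; exists (idx_to_j v); first by rewrite -iltE.
  rewrite ha //; apply: leq_trans hs; rewrite -!mdeg_idx; apply/jle_mdeg/jltW.
  by rewrite -iltE.
move=> [v hv ->]; have hd := jle_mdeg (jltW hv); rewrite mdeg_idx in hd.
have hv2 := leq_trans hd hs; apply: genfield_gen; exists (j_to_idx v); split.
  by rewrite iltE j_to_idxK.
by rewrite ha -?mdeg_idx j_to_idxK.
Qed.

(** The differential condition at this greatest index of order 2r - 1 covers all polynomials in the
    generators of order below 2r at once. *)
Lemma idx_max : (0 < r)%N -> (0 < n)%N -> (0 < m)%N ->
  exists s, (absx s.1).+1 = (2 * r)%N /\ forall v, (absx v.1 < 2 * r)%N -> ile v s.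
Proof.
move=> r0 n0 m0.
pose i0 := Ordinal m0; pose w0 : J := ((U_(i0) *+ (2 * r).-1)%MM, Ordinal n0).
have dw0 : mdeg w0.1 = (2 * r).-1 by rewrite mdegMn mdeg1 mul1n.
pose s0 : Idx m r n := j_to_idx w0.
have ds0 : absx s0.1 = (2 * r).-1 by rewrite -mdeg_idx j_to_idxK // dw0; lia.
pose P v := (absx v.1 < 2 * r)%N.
have Ps0 : P s0 by rewrite /P ds0; lia.
(* The order is reversed, so the extremum is a maximum. *)
have [||||s Ps hs] := @extremumP _ _ (fun x y => ile y x) s0 P id.
- by move=> v; rewrite ileE jle_refl.
- by move=> v u w; rewrite !ileE => h1 h2; exact: jle_trans h2 h1.
- by move=> v u; rewrite !ileE; exact: lexle_total.
- exact: Ps0.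
exists s; split; last by move=> v; exact: hs.
have := jle_mdeg (_ : jle (idx_to_j s0) (idx_to_j s)); rewrite -ileE !mdeg_idx ds0.
by move=> /(_ (hs _ Ps0)); move: Ps; rewrite /P; lia.
Qed.
End Reindex.

Section Mpoly.
Variables (K L : fieldType) (iota : {rmorphism K -> L}) (N : nat).
Implicit Types (f g : {mpoly K[N]}) (h : 'I_N -> L).

Lemma mpoly_additive_ind (P : {mpoly K[N]} -> Prop) :
  P 0 -> (forall c x, P (c *: 'X_[x])) -> (forall f g, P f -> P g -> P (f + g)) -> forall f, P f.
Proof. by move=> P0 PX PD; elim/mpolyind => // c x p _ _ hp; exact: PD. Qed.

Lemma mmap_agree (V : pred 'I_N) f h h' :
  (forall x, x \in msupp f -> forall j, ~~ V j -> x j = 0%N) ->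
  (forall j, V j -> h j = h' j) -> mmap iota h f = mmap iota h' f.
Proof.
move=> hf hh; apply: eq_big_seq => x hx; congr (_ * _).
apply: eq_bigr => j _; case: (boolP (V j)) => [/hh -> //|nj].
by rewrite (hf _ hx _ nj) !expr0.
Qed.

Lemma mderiv_unused f j : (forall x, x \in msupp f -> x j = 0%N) -> mderiv j f = 0.
Proof.
move=> hf; rewrite /mderiv big_seq big1 // => x /hf ->.
by rewrite mul0r scale0r.
Qed.

Section Derivative.
Variables (d : K -> K) (Hd : derivation d).

Lemma derivationB : zmod_morphism d.
Proof.
have [dD _] := Hd.
have d0 : d 0 = 0 by apply: (addrI (d 0)); rewrite -dD !addr0.
have dN y : d (- y) = - d y by apply: (addrI (d y)); rewrite -dD !subrr d0.
by move=> x y; rewrite dD dN.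
Qed.

Definition additive_of (_ : derivation d) := d.
HB.instance Definition _ := GRing.isZmodMorphism.Build K K (additive_of Hd) derivationB.

Lemma map_mpolyZX c (x : 'X_{1..N}) : map_mpoly d (c *: 'X_[x]) = d c *: 'X_[x].
Proof.
change (map_mpoly (additive_of Hd) (c *: 'X_[x]) = d c *: 'X_[x]).
apply/mpolyP => y; rewrite mcoeff_map_mpoly !mcoeffZ mcoeffX /additive_of.
by case: (_ == _); rewrite ?mulr1 ?mulr0 // (raddf0 (additive_of Hd)).
Qed.

Lemma map_mpoly_derD f g : map_mpoly d (f + g) = map_mpoly d f + map_mpoly d g.
Proof. exact: (raddfD (map_mpoly (additive_of Hd))). Qed.

Lemma map_mpoly_derM f g :
  map_mpoly d (f * g) = map_mpoly d f * g + f * map_mpoly d g.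
Proof.
have m0 : map_mpoly d 0 = 0 :> {mpoly K[N]} by exact: (raddf0 (map_mpoly (additive_of Hd))).
elim/mpoly_additive_ind: f => [|c x|f1 f2 h1 h2].
- by rewrite m0 !mul0r m0 addr0.
- elim/mpoly_additive_ind: g => [|e y|g1 g2 h1 h2].
  + by rewrite m0 !mulr0 m0 addr0.
  + rewrite -scalerAl -scalerAr -mpolyXD scalerA !map_mpolyZX (proj2 Hd) scalerDl.
    by rewrite -!scalerAl -!scalerAr -mpolyXD !scalerA.
  + by rewrite !mulrDr !map_mpoly_derD h1 h2 !mulrDr; ring.
- by rewrite !mulrDl !map_mpoly_derD h1 h2 !mulrDl; ring.
Qed.

(** The left-hand side of the differential condition, with h the values of the variables and h' the
    values intended for their derivatives. *)
Definition total_deriv h h' f : L :=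
  \sum_(j < N) mmap iota h (mderiv j f) * h' j + mmap iota h (map_mpoly d f).

Lemma total_derivD h h' f g :
  total_deriv h h' (f + g) = total_deriv h h' f + total_deriv h h' g.
Proof.
rewrite /total_deriv map_mpoly_derD mmapD addrACA -big_split /=; congr (_ + _).
by apply: eq_bigr => j _; rewrite mderivD mmapD mulrDl.
Qed.

Lemma total_derivM h h' f g : total_deriv h h' (f * g) =
  total_deriv h h' f * mmap iota h g + mmap iota h f * total_deriv h h' g.
Proof.
rewrite /total_deriv map_mpoly_derM mmapD !(rmorphM (mmap iota h)) mulrDl mulrDr addrACA.
congr (_ + _); rewrite mulr_suml mulr_sumr -big_split; apply: eq_bigr => j _ /=.
by rewrite mderivM mmapD !(rmorphM (mmap iota h)); ring.
Qed.

Lemma total_derivC h h' c : total_deriv h h' c%:MP = iota (d c).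
Proof.
rewrite /total_deriv big1 ?add0r => [|j _]; last by rewrite mderivC mmap0 mul0r.
by rewrite -(mulr1 c%:MP) mul_mpolyC -mpolyX0 map_mpolyZX mmapZ mpolyX0 (rmorph1 (mmap iota h)) mulr1.
Qed.

Lemma total_derivX h h' j : total_deriv h h' 'X_j = h' j.
Proof.
have d1 : d 1 = 0.
  have [_ dM] := Hd; apply: (addrI (d 1)); rewrite addr0 -{3}(mulr1 1) dM.
  by rewrite mulr1 mul1r.
rewrite /total_deriv -[X in map_mpoly d X]scale1r map_mpolyZX d1 scale0r mmap0 addr0.
rewrite (bigD1 j) //= big1 ?addr0 => [|l ne]; rewrite mderivX mnm1E.
  by rewrite eqxx scale1r (_ : (U_(j) - U_(j))%MM = 0%MM) ?mpolyX0 ?(rmorph1 (mmap iota h)) ?mul1r //;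
      apply/mnmP => l; rewrite mnmBE subnn mnm0E.
by rewrite eq_sym (negbTE ne) scale0r mmap0 mul0r.
Qed.

(** Both sides are additive and obey the Leibniz rule, so it suffices to compare them on constants
    and variables. *)
Lemma chain_rule (D : L -> L) h f : derivation D -> (forall c, D (iota c) = iota (d c)) ->
  D (mmap iota h f) = total_deriv h (fun j => D (h j)) f.
Proof.
move=> [DD DM] DK.
have D0 : D 0 = 0 by apply: (addrI (D 0)); rewrite -DD !addr0.
have T0 : total_deriv h (fun j => D (h j)) 0 = 0.
  by apply: (addrI (total_deriv h (fun j => D (h j)) 0)); rewrite -total_derivD !addr0.
elim/mpoly_additive_ind: f => [|c x|f g h1 h2]; first by rewrite mmap0 D0 T0.
  rewrite -mul_mpolyC (rmorphM (mmap iota h)) /= DM mmapC DK total_derivM total_derivC mmapC.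
  congr (_ + _ * _).
  rewrite mpolyXE_id; elim/big_ind: _ => [|f g h1 h2|j _].
  - by rewrite -mpolyC1 mmapC total_derivC DK.
  - by rewrite (rmorphM (mmap iota h)) /= DM total_derivM h1 h2.
  elim: (x j) => [|k IH]; first by rewrite expr0 -mpolyC1 mmapC total_derivC DK.
  by rewrite exprS (rmorphM (mmap iota h)) /= DM IH total_derivM total_derivX mmapX mmap1U.
by rewrite mmapD DD h1 h2 total_derivD.
Qed.
End Derivative.
End Mpoly.

(** * From specializations to existential closedness *)

Section Dpow.
Variables (m : nat) (L : Type) (d : 'I_m -> L -> L).
Hypothesis comm : forall i j x, d i (d j x) = d j (d i x).

Lemma dpow_ext (xi eta : 'I_m -> nat) x : xi =1 eta -> dpow d xi x = dpow d eta x.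
Proof. by move=> e; rewrite /dpow; elim: (enum _) => //= i s ->; rewrite e. Qed.

Lemma iter_comm i j k x : d i (iter k (d j) x) = iter k (d j) (d i x).
Proof. by elim: k => //= k <-; rewrite comm. Qed.

Lemma dpowS i (xi eta : 'I_m -> nat) x : (forall j, eta j = (xi j + (i == j))%N) ->
  dpow d eta x = d i (dpow d xi x).
Proof.
move=> he; rewrite /dpow.
have H s : uniq s -> foldr (fun j y => iter (eta j) (d j) y) x s =
    (if i \in s then d i else id) (foldr (fun j y => iter (xi j) (d j) y) x s).
  elim: s => //= j s IH /andP [js /IH ->]; rewrite in_cons he.
  case: (eqVneq i j) js => [<-|ne] js; last first.
    by rewrite addn0 /=; case: ifP => //= _; rewrite iter_comm.
  by rewrite (negbTE js) addn1.
by rewrite (H _ (enum_uniq _)) mem_enum.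
Qed.

Lemma dpow0 x : dpow d (fun _ => 0%N) x = x.
Proof. by rewrite /dpow; elim: (enum _). Qed.
End Dpow.

Section Translation.
Variables (m : nat) (K : fieldType) (d : 'I_m -> K -> K).

Definition dpoint (L : Type) (dL : 'I_m -> L -> L) r n (y : 'I_n -> L) (v : Idx m r n) : L :=
  dpow dL (fun i => (v.1 i : nat)) (y v.2).

Lemma dpoint_shift (L : Type) (dL : 'I_m -> L -> L) r n (y : 'I_n -> L) i (v : Idx m r n) :
  (forall i j x, dL i (dL j x) = dL j (dL i x)) -> (absx v.1 < 2 * r)%N ->
  dpoint dL y (ishift i v) = dL i (dpoint dL y v).
Proof.
move=> comm hv; apply: dpowS => // j.
have := congr1 (fun w : 'X_{1..m} * 'I_n => w.1 j) (idx_shift i hv); rewrite /= mnmE => ->.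
by rewrite mnmDE mnm1E mnmE.
Qed.

Inductive ord_poly r n (o : nat) : IPoly K m r n -> Prop :=
| OrdC c : ord_poly o c%:MP
| OrdX v : (absx v.1 <= o)%N -> ord_poly o 'X_(enum_rank v)
| OrdD f g : ord_poly o f -> ord_poly o g -> ord_poly o (f + g)
| OrdM f g : ord_poly o f -> ord_poly o g -> ord_poly o (f * g).

Lemma ord_poly_mono r n o o' (f : IPoly K m r n) :
  (o <= o')%N -> ord_poly o f -> ord_poly o' f.
Proof.
move=> le; elim=> {f} [c|v h|f g _ hf _ hg|f g _ hf _ hg]; first exact: OrdC.
- by apply: OrdX; apply: leq_trans le.
- exact: OrdD.
- exact: OrdM.
Qed.

Lemma ord_poly_vars r n o (f : IPoly K m r n) : (o < 2 * r)%N -> ord_poly o f ->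
  vars_in (fun v => (absx v.1 < 2 * r)%N) f.
Proof.
move=> le; elim=> {f} [c|v h|f g _ hf _ hg|f g _ hf _ hg] x.
- by rewrite msuppC; case: (c == 0) => //; rewrite inE => /eqP -> j _; rewrite mnm0E.
- rewrite msuppX inE => /eqP -> j; rewrite mnm1E; case: eqP => // <-.
  by rewrite enum_rankK (leq_ltn_trans h le).
- by move=> /msuppD_le; rewrite mem_cat => /orP [/hf|/hg].
- move=> /msuppM_le /allpairsP [[y z] /= [/hf hy /hg hz ->]] j nj.
  by rewrite mnmDE hy ?hz.
Qed.

Section Point.
Variables (L : fieldType) (dL : 'I_m -> L -> L) (iota : {rmorphism K -> L}).
Definition diff_extension := commuting_derivations dL /\
  forall i c, dL i (iota c) = iota (d i c).
End Point.

(** The polynomial g does not depend on the extension L. This uniformity lets an identity found in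
    an extension be read back in K. *)
Lemma ord_poly_deriv r n o (f : IPoly K m r n) i : (o < 2 * r)%N -> ord_poly o f ->
  exists2 g : IPoly K m r n, ord_poly o.+1 g & forall (L : fieldType) dL (iota : {rmorphism K -> L}) y,
    diff_extension dL iota -> evalI iota (dpoint dL y) g = dL i (evalI iota (dpoint dL y) f).
Proof.
move=> le; elim=> {f} [c|v h|f g hf [f' hf' ef] hg [g' hg' eg]|f g hf [f' hf' ef] hg [g' hg' eg]].
- exists (d i c)%:MP => [|L dL iota y [_ hK]]; first exact: OrdC.
  by rewrite /evalI !mmapC hK.
- exists 'X_(enum_rank (ishift i v)) => [|L dL iota y [[_ hc] _]].
    by apply: OrdX; rewrite absx_shift ?ltnS //; exact: leq_ltn_trans h le.
  rewrite /evalI !mmapX !mmap1U !enum_rankK dpoint_shift //; exact: leq_ltn_trans h le.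
- exists (f' + g') => [|L dL iota y hd]; first exact: OrdD.
  rewrite /evalI !mmapD -!/(evalI _ _ _) ef ?eg //.
  by have [[/(_ i) [-> _] _] _] := hd.
- exists (f' * g + f * g') => [|L dL iota y hd].
    by apply: OrdD; apply: OrdM => //; exact: ord_poly_mono (leqnSn _) _.
  rewrite /evalI mmapD !(rmorphM (mmap iota _)) /= -!/(evalI _ _ _) ef ?eg //.
  by have [[/(_ i) [_ ->] _] _] := hd.
Qed.

Fixpoint dord n (t : dterm m n K) : nat :=
  match t with
  | DVar _ | DConst _ => 0
  | DAdd t1 t2 | DMul t1 t2 => maxn (dord t1) (dord t2)
  | DOpp t1 => dord t1
  | DDer _ t1 => (dord t1).+1
  end.

Lemma dterm_poly r n (t : dterm m n K) : (dord t < 2 * r)%N ->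
  exists2 f : IPoly K m r n, ord_poly (dord t) f &
    forall (L : fieldType) dL (iota : {rmorphism K -> L}) y,
    diff_extension dL iota -> evalI iota (dpoint dL y) f = deval iota dL y t.
Proof.
elim: t => [k|c|t1 IH1 t2 IH2|t1 IH1|t1 IH1 t2 IH2|i t1 IH1] /= h.
- pose v : Idx m r n := ([ffun=> ord0], k).
  have v0 : absx v.1 = 0%N by rewrite /absx big1 // => i _; rewrite ffunE.
  exists 'X_(enum_rank v) => [|L dL iota y _]; first by apply: OrdX; rewrite v0.
  rewrite /evalI mmapX mmap1U enum_rankK /dpoint -[RHS](dpow0 dL).
  by apply: dpow_ext => i; rewrite ffunE.
- exists c%:MP => [|L dL iota y _]; first exact: OrdC.
  by rewrite /evalI mmapC.
- move: h; rewrite gtn_max => /andP [/IH1 [f hf ef] /IH2 [g hg eg]].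
  exists (f + g) => [|L dL iota y hd]; last by rewrite -ef // -eg // /evalI mmapD.
  by apply: OrdD; [apply: ord_poly_mono (leq_maxl _ _) hf|apply: ord_poly_mono (leq_maxr _ _) hg].
- have [f hf ef] := IH1 h.
  exists ((- 1)%:MP * f) => [|L dL iota y hd]; first by apply: OrdM => //; exact: OrdC.
  by rewrite -ef // mul_mpolyC scaleN1r /evalI mmapN.
- move: h; rewrite gtn_max => /andP [/IH1 [f hf ef] /IH2 [g hg eg]].
  exists (f * g) => [|L dL iota y hd]; last by rewrite -ef // -eg // /evalI (rmorphM (mmap iota _)).
  by apply: OrdM; [apply: ord_poly_mono (leq_maxl _ _) hf|apply: ord_poly_mono (leq_maxr _ _) hg].
- have [f hf ef] := IH1 (ltnW h).
  have [g hg eg] := ord_poly_deriv i (ltnW h) hf.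
  by exists g => // L dL iota y hd; rewrite eg // ef.
Qed.

Fixpoint dsubst N n (s : 'I_N -> 'I_n) (t : dterm m N K) : dterm m n K :=
  match t with
  | DVar j => DVar _ _ (s j)
  | DConst c => DConst _ _ c
  | DAdd t1 t2 => DAdd (dsubst s t1) (dsubst s t2)
  | DOpp t1 => DOpp (dsubst s t1)
  | DMul t1 t2 => DMul (dsubst s t1) (dsubst s t2)
  | DDer i t1 => DDer i (dsubst s t1)
  end.

Lemma deval_subst N n (s : 'I_N -> 'I_n) (t : dterm m N K) (L : fieldType) dL
  (iota : K -> L) y : deval iota dL y (dsubst s t) = deval iota dL (fun j => y (s j)) t.
Proof. by elim: t => //= [t1 -> t2 ->|t1 ->|t1 -> t2 ->|i t1 ->]. Qed.

Lemma dpoint_diff_condition (L : fieldType) dL (iota : {rmorphism K -> L}) r n (y : 'I_n -> L) :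
  (forall i, derivation (d i)) -> diff_extension dL iota ->
  diff_condition (r := r) d iota (dpoint dL y).
Proof.
move=> Hd [[HdL comm] hK] i s hs f fv ef.
have := chain_rule (iota := iota) (Hd i) (fun j => dpoint dL y (enum_val j)) f (HdL i) (hK i).
rewrite -/(evalI _ _ _) ef.
have -> : dL i 0 = 0.
  by have [DD _] := HdL i; apply: (addrI (dL i 0)); rewrite -DD !addr0.
rewrite /total_deriv => /esym e0; apply: etrans e0; congr (_ + _).
rewrite [RHS](reindex enum_rank) /=; last by exists enum_val => j _; rewrite ?enum_rankK ?enum_valK.
rewrite big_mkcond /=; apply: eq_bigr => v _; rewrite enum_rankK.
case: ifP => hv; last first.
  rewrite mderiv_unused ?mmap0 ?mul0r // => x hx; apply: fv hx _ _.
  by rewrite enum_rankK hv.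
rewrite dpoint_shift //; have := jle_mdeg (_ : jle (idx_to_j v) (idx_to_j s)).
by rewrite -ileE hv !mdeg_idx => /(_ isT) hle; exact: leq_ltn_trans hle hs.
Qed.

Definition specialization_property := forall (r n : nat), (0 < r)%N -> (0 < n)%N ->
   forall (L : fieldType) (iota : {rmorphism K -> L}) (a : Idx m r n -> L),
     diff_condition d iota a ->
     (forall s : Idx m r n, (absx s.1 <= 2 * r)%N -> min_sep_leader iota a s ->
        (absx s.1 <= r)%N) ->
     exists b : 'I_n -> K, is_specialization d iota a b.

(** For each component k, Dickson's lemma gives finitely many leaders [B k] below which no leader
    escapes minimality; R is their greatest order. A minimal leader must coincide with the element
    of [B k] under it, for every truncation 2r. *)
Lemma min_leader_bound (L : fieldType) dL (iota : {rmorphism K -> L}) n (y : 'I_n -> L) :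
  exists R, forall r (s : Idx m r n), (R <= r)%N -> (absx s.1 <= 2 * r)%N ->
    min_sep_leader iota (dpoint dL y) s -> (absx s.1 <= r)%N.
Proof.
pose aJ (w : 'X_{1..m} * 'I_n) := dpow dL w.1 (y w.2).
have aE r (v : Idx m r n) : dpoint dL y v = aJ (idx_to_j v).
  by apply: dpow_ext => i; rewrite mnmE.
have [B hB] : exists B : 'I_n -> seq 'X_{1..m}, forall k,
    (forall x, x \in B k -> jlead iota aJ (x, k)) /\
    forall x, jlead iota aJ (x, k) -> exists2 y, y \in B k & (y <= x)%MM.
  apply: (choice_fun (R := fun k (B : seq 'X_{1..m}) =>
    (forall x, x \in B -> jlead iota aJ (x, k)) /\
    forall x, jlead iota aJ (x, k) -> exists2 y, y \in B & (y <= x)%MM)) => k.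
  exact: dickson.
exists (\max_(k < n) \max_(x <- B k) mdeg x) => r s hR hs [ls mins].
have [B1 B2] := hB s.2.
have ls' : jlead iota aJ (idx_to_j s) by apply/(sep_leaderE _ (fun v _ => aE r v)).
have [x xB le] := B2 _ ls'.
have dx : (mdeg x <= r)%N.
  apply: leq_trans hR; rewrite (bigD1 s.2) //= (big_rem x) //=.
  by rewrite -maxnA leq_maxl.
have le_d : (mdeg x <= 2 * r)%N by lia.
have ex := j_to_idxK (w := (x, s.2)) le_d.
have [e|ne] := eqVneq (j_to_idx r (x, s.2)).1 s.1.
  by rewrite -e -mdeg_idx ex.
exfalso; apply: (mins _ _ ne) => [j|].
  have /mnm_lepP /(_ j) := le; rewrite mnmE; apply: leq_trans.
  by have /(congr1 (fun w : 'X_{1..m} * 'I_n => w.1 j)) /= := ex; rewrite mnmE => ->.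
apply/(sep_leaderE _ (fun v _ => aE r v)); first by rewrite -mdeg_idx ex.
by rewrite [(_, _)]/(j_to_idx r (x, s.2)) ex; exact: B1.
Qed.

Lemma ex_closed_of_specialization : commuting_derivations d ->
  specialization_property -> ex_closed_mDF d.
Proof.
move=> [Hd Hc] H N p q E F [L [dL [iota [HdL [hK [x [hE hF]]]]]]].
have hL : diff_extension dL iota by [].
have hKK : diff_extension d idfun by [].
(* N given unknowns, q inverses of the left-hand sides of the inequations, and one spare unknown
   with value 0 that keeps n positive. *)
pose n := (N + q).+1.
pose inl (j : 'I_N) : 'I_n := inord j.
pose inr (j : 'I_q) : 'I_n := inord (N + j).
pose y (k : 'I_n) : L := if insub (val k) is Some j then x j else
  if insub (val k - N)%N is Some j then (deval iota dL x (F j))^-1 else 0.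
have yl j : y (inl j) = x j.
  rewrite /y /inl /= inordK ?valK // /n; have := ltn_ord j; lia.
have yr j : y (inr j) = (deval iota dL x (F j))^-1.
  rewrite /y /inr /= inordK ?addKn; last by rewrite /n; have := ltn_ord j; lia.
  by rewrite insubN ?valK // -leqNgt leq_addr.
pose E' j := dsubst inl (E j).
(* Rabinowitsch: y_j F_j = 1 replaces the inequation F_j <> 0. *)
pose F' j := DAdd (DMul (dsubst inl (F j)) (DVar _ _ (inr j))) (DConst m n (-1)).
have [R hR] := min_leader_bound dL iota y.
(* Large enough for the minimal leaders to have order at most r and for all terms to have order
   below 2r. *)
pose r := (R + \max_j dord (E' j) + \max_j dord (F' j)).+1.
have hr : (R <= r)%N by rewrite /r; lia.
have lE j : (dord (E' j) < 2 * r)%N.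
  by have := @leq_bigmax _ (fun j => dord (E' j)) j; rewrite /r; lia.
have lF j : (dord (F' j) < 2 * r)%N.
  by have := @leq_bigmax _ (fun j => dord (F' j)) j; rewrite /r; lia.
have [|b hb] := H r n isT isT L iota (dpoint dL y) (dpoint_diff_condition (y := y) Hd hL) _.
  by move=> s; exact: hR.
have key (t : dterm m n K) : (dord t < 2 * r)%N -> deval iota dL y t = 0 ->
    deval id d b t = 0.
  move=> ht et; have [f hf ef] := dterm_poly ht.
  have := hb f (ord_poly_vars ht hf); rewrite ef // => /(_ et).
  by rewrite -(ef K d idfun b hKK).
exists (fun j => b (inl j)); split=> j.
  rewrite -(deval_subst inl (E j) d idfun b); apply: key (lE j) _.
  by rewrite deval_subst -[RHS](hE j); congr deval; apply: functional_extensionality.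
have := key (F' j) (lF j).
rewrite /= !deval_subst yr (_ : (fun j => y (inl j)) = x); last exact: functional_extensionality.
rewrite divff // (rmorphN1 iota) subrr => /(_ erefl) /eqP; rewrite subr_eq0 => /eqP h.
by apply/eqP => h0; move: h; rewrite h0 mul0r => /eqP; rewrite eq_sym oner_eq0.
Qed.
End Translation.

(** * Prolongation *)

Section MultiIndex.
Variable m : nat.
Implicit Types (x y z : 'X_{1..m}) (i l : 'I_m).

(** z is the componentwise minimum of x and y, so a leader below both x and y is below z. *)
Lemma mnm_diamond x y i l : i != l -> (x + U_(i) = y + U_(l))%MM ->
  exists z, [/\ x = (z + U_(l))%MM, y = (z + U_(i))%MM &
    forall u, (u <= x)%MM -> (u <= y)%MM -> (u <= z)%MM].
Proof.
move=> il /mnmP e; exists (x - U_(l))%MM.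
have e' k : (x k + (i == k) = y k + (l == k))%N by have := e k; rewrite !mnmDE !mnm1E.
split; first (apply/mnmP => k; rewrite mnmDE mnmBE !mnm1E).
- have := e' k; case: (eqVneq l k) => [<-|_]; last by lia.
  by rewrite (negbTE il) /=; lia.
- apply/mnmP => k; rewrite mnmDE mnmBE !mnm1E.
  have := e' k; case: (eqVneq l k) => [<-|_] /=; last by lia.
  by rewrite (negbTE il) /=; lia.
- move=> u /mnm_lepP h1 /mnm_lepP h2; apply/mnm_lepP => k; rewrite mnmBE mnm1E.
  have := e' k; have := h1 k; have := h2 k.
  case: (eqVneq l k) => [<-|_] /=; last by lia.
  by rewrite (negbTE il) /=; lia.
Qed.

Lemma mnm_room x y : (x <= y)%MM -> (mdeg x < mdeg y)%N ->
  exists i z, y = (z + U_(i))%MM /\ (x <= z)%MM.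
Proof.
move=> /mnm_lepP le lt.
have [i hi] : exists i, (x i < y i)%N.
  apply/not_all_not_ex => h; move: lt; rewrite ltnNge => /negP; apply.
  by rewrite !mdegE; apply: leq_sum => i _; have := h i; lia.
exists i, (y - U_(i))%MM; split.
  apply/mnmP => k; rewrite mnmDE mnmBE mnm1E.
  by case: (eqVneq i k) => [<-|_] /=; lia.
apply/mnm_lepP => k; rewrite mnmBE mnm1E; have := le k.
by case: (eqVneq i k) => [<-|_] /=; lia.
Qed.

Lemma mdeg_mlcm x y : (mdeg (mlcm x y) <= mdeg x + mdeg y)%N.
Proof. by rewrite !mdegE -big_split; apply: leq_sum => i _; rewrite mnmE /=; lia. Qed.

Lemma mnm_ind (P : 'X_{1..m} -> Prop) :
  P 0%MM -> (forall i x, P x -> P (x + U_(i))%MM) -> forall x, P x.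
Proof.
move=> P0 PS x; have [n] := ubnP (mdeg x); elim: n x => // n IH x hx.
have [/eqP|h] := posnP (mdeg x); first by rewrite mdeg_eq0 => /eqP ->.
have [||i [z [e _]]] := @mnm_room 0%MM x; last first.
- by rewrite e; apply/PS/IH; move: hx; rewrite e mdegD mdeg1; lia.
- by rewrite mdeg0.
- by apply/mnm_lepP => i; rewrite mnm0E.
Qed.
End MultiIndex.

Lemma jshiftC m n i l (v : 'X_{1..m} * 'I_n) : jshift i (jshift l v) = jshift l (jshift i v).
Proof. by congr (_, _); rewrite -!addmA [(U_(l) + _)%MM]addmC. Qed.

Lemma jlt_wf m n : well_founded (fun v w : 'X_{1..m} * 'I_n => jlt v w).
Proof. by move=> v; elim/jlt_ind: v => v IH; constructor. Qed.

(** Well-founded recursion in which the step receives a total function, set to 0 outside the indices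
    below w, so that the equation for c carries no proof arguments. *)
Lemma jlt_rec m n (Q : nmodType) (step : 'X_{1..m} * 'I_n -> ('X_{1..m} * 'I_n -> Q) -> Q) :
  exists c, forall w, c w = step w (fun u => if jlt u w then c u else 0).
Proof.
pose body w (rec : forall u, jlt u w -> Q) :=
  step w (fun u => match Sumbool.sumbool_of_bool (jlt u w) with
                   | left h => rec u h | right _ => 0 end).
exists (Fix (@jlt_wf m n) (fun _ => Q) body) => w.
rewrite Fix_eq /=; last first.
  move=> x f g fg; congr step; apply: functional_extensionality => u.
  by case: Sumbool.sumbool_of_bool.
congr step; apply: functional_extensionality => u.
by case: Sumbool.sumbool_of_bool => h; rewrite h.
Qed.

Section Prolongation.
Variables (m n r : nat) (i0 : 'I_m) (K F Q : fieldType) (d : 'I_m -> K -> K).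
Notation J := ('X_{1..m} * 'I_n)%type.
Variables (kappa : {rmorphism K -> F}) (alpha : J -> F).
Variables (e : {rmorphism F -> Q}) (t : J -> Q).
Variables (base : J -> Prop) (delta : 'I_m -> F -> Q) (c2 : J -> Q).

(** [base] is to be the set of separable leaders of order at most r. *)
Definition lead (w : J) := exists2 rho, (rho <= w.1)%MM & base (rho, w.2).
(** The indices at which the new tuple takes the transcendental value t w. *)
Definition param (w : J) := ~ lead w /\ (2 * r <= mdeg w.1)%N.
Definition tfield (P : J -> Prop) := in_genfield e (fun y => exists2 u, param u /\ P u & y = t u).

Let eK : {rmorphism K -> Q} := GRing.RMorphism.clone _ _ (e \o kappa) _.

Hypothesis d_comm : forall i l x, d i (d l x) = d l (d i x).
Hypothesis base_le : forall w, base w -> (mdeg w.1 <= r)%N.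
Hypothesis F_gen : forall x,
  in_genfield kappa (fun y => exists2 v, (mdeg v.1 < 2 * r)%N & y = alpha v) x.
Hypothesis Q_gen : forall x, in_genfield e (fun y => exists v, y = t v) x.
Hypothesis Q_ext : forall (del : F -> Q) (u : J -> Q), deriv_along e del ->
  exists D : Q -> Q, [/\ deriv_along idfun D,
    forall x, D (e x) = del x & forall v, D (t v) = u v].
Hypothesis delta_deriv : forall i, deriv_along e (delta i).
Hypothesis delta_K : forall i x, delta i (kappa x) = e (kappa (d i x)).
Hypothesis delta_lo : forall i v, ((mdeg v.1).+1 < 2 * r)%N ->
  delta i (alpha v) = e (alpha (jshift i v)).
Hypothesis delta_mid : forall i v, (mdeg v.1).+1 = (2 * r)%N ->
  delta i (alpha v) = c2 (jshift i v).
Hypothesis delta_range : forall i x, tfield (fun u => mdeg u.1 = (2 * r)%N) (delta i x).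
Hypothesis c2_lead : forall w, mdeg w.1 = (2 * r)%N -> lead w -> tfield (fun u => jlt u w) (c2 w).
Hypothesis c2_param : forall w, mdeg w.1 = (2 * r)%N -> ~ lead w -> c2 w = t w.
Hypothesis lead_sep : forall w, (mdeg w.1 < 2 * r)%N -> lead w ->
  sep_alg_over kappa (fun y => exists2 v, jlt v w & y = alpha v) (alpha w).

Lemma lead_shift i v : lead v -> lead (jshift i v).
Proof. by move=> [rho h1 h2]; exists rho => //=; apply: lepm_trans h1 (lem_addr _ _). Qed.

Lemma lead_pred w : lead w -> (r < mdeg w.1)%N -> exists i v, w = jshift i v /\ lead v.
Proof.
case: w => x k [rho /= h1 h2] h.
have [|i [z [ez hz]]] := mnm_room h1; first exact: leq_ltn_trans (base_le h2) h.
by exists i, (z, k); rewrite ez; split=> //; exists rho.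
Qed.

Lemma tfield_sub (P P' : J -> Prop) y : (forall u, P u -> P' u) -> tfield P y -> tfield P' y.
Proof.
move=> h; apply: genfield_sub => _ [u [pu Pu] ->].
by apply: genfield_gen; exists u => //; split=> //; exact: h.
Qed.

Lemma tfield_e (P : J -> Prop) x : tfield P (e x). Proof. exact: genfield_const. Qed.

(** The derivation D_i must send t_v to c at v + e_i, while c is itself defined through D_i. The
    circle is broken by recursion along the order: c_w is computed with a provisional derivation
    that knows only the values of c below w, and D_i is defined once c is complete. *)
Lemma prolongation : exists (D : 'I_m -> Q -> Q) (c : J -> Q),
  [/\ commuting_derivations D, forall i x, D i (eK x) = eK (d i x),
      forall v, (mdeg v.1 < 2 * r)%N -> c v = e (alpha v)
    & forall i v, D i (c v) = c (jshift i v)].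
Proof.
have [ext extP] : exists ext : 'I_m -> (J -> Q) -> Q -> Q, forall i u,
    [/\ deriv_along idfun (ext i u), forall x, ext i u (e x) = delta i x &
      forall v, ext i u (t v) = u v].
  have [ext h] := choice_fun (R := fun (p : 'I_m * (J -> Q)) (D : Q -> Q) =>
    [/\ deriv_along idfun D, forall x, D (e x) = delta p.1 x & forall v, D (t v) = p.2 v])
    (fun p => Q_ext p.2 (delta_deriv p.1)).
  by exists (fun i u => ext (i, u)) => i u; exact: (h (i, u)).
have [pick pickP] : exists pick : J -> 'I_m * J, forall w, lead w -> (2 * r < mdeg w.1)%N ->
    w = jshift (pick w).1 (pick w).2 /\ lead (pick w).2.
  apply: (choice_fun (R := fun w (p : 'I_m * J) => lead w -> (2 * r < mdeg w.1)%N ->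
    w = jshift p.1 p.2 /\ lead p.2)) => w.
  have [[lw hw]|h] := classic (lead w /\ (2 * r < mdeg w.1)%N); last first.
    by exists (i0, w) => lw hw; case: h.
  have [|i [v h]] := lead_pred lw; first by lia.
  by exists (i, v).
(* The default 0 is harmless: with w = v + e_i, the element c_v involves only t_u with u below v,
   and then u + e_i is below w. *)
pose below (f : J -> Q) i w u := if jlt (jshift i u) w then f (jshift i u) else 0.
pose step w f : Q :=
  if (mdeg w.1 < 2 * r)%N then e (alpha w) else
  if mdeg w.1 == (2 * r)%N then c2 w else
  if excluded_middle_informative (lead w)
  then ext (pick w).1 (below f (pick w).1 w) (f (pick w).2) else t w.
have [c cE] := jlt_rec step.
have c_lo v : (mdeg v.1 < 2 * r)%N -> c v = e (alpha v).
  by move=> h; rewrite cE /step h.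
have c_mid v : mdeg v.1 = (2 * r)%N -> c v = c2 v.
  by move=> h; rewrite cE /step h ltnn eqxx.
have c_par v : param v -> c v = t v.
  move=> [nl hv]; case: (eqVneq (mdeg v.1) (2 * r)%N) => h; first by rewrite c_mid // c2_param.
  by rewrite cE /step ltnNge hv /= (negbTE h); case: excluded_middle_informative.
have c_hi w : lead w -> (2 * r < mdeg w.1)%N -> c w =
    ext (pick w).1 (below c (pick w).1 w) (c (pick w).2).
  move=> lw hw; rewrite cE /step ltnNge (ltnW hw) /= gtn_eqF //.
  case: (excluded_middle_informative (lead w)) => [lw2|//]; have [ew _] := pickP w lw hw.
  have lt : jlt (pick w).2 w = true by have := jlt_shift (pick w).1 (pick w).2; rewrite -ew.
  rewrite lt; congr (ext _ _ _); apply: functional_extensionality => u.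
  by rewrite /below; case: ifP => // ->.
have c_below w u : jlt u w ->
    (lead u -> (2 * r <= mdeg u.1)%N -> tfield (fun x => jlt x u) (c u)) ->
    tfield (fun x => jlt x w) (c u).
  move=> uw h; case: (ltnP (mdeg u.1) (2 * r)%N) => hu.
    by rewrite c_lo //; exact: tfield_e.
  have [lu|nl] := classic (lead u).
    by apply: tfield_sub (h lu hu) => x xu; exact: jlt_trans xu uw.
  by rewrite c_par //; apply: genfield_gen; exists u.
(* Beyond order 2r, c_w is the derivative of c_v, a rational function over F of the t_u with u below
   v. The derivation sends F into F(t_u : |u| = 2r) and t_u to c at u + e_i, which is below w, so
   the values stay in the field of the parameters below w. *)
have c_lead w : lead w -> (2 * r <= mdeg w.1)%N -> tfield (fun x => jlt x w) (c w).
  elim/jlt_ind: w => w IH lw hw; case: (eqVneq (mdeg w.1) (2 * r)%N) => [h|ne].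
    by rewrite c_mid //; exact: c2_lead.
  have {ne} hw' : (2 * r < mdeg w.1)%N by rewrite ltn_neqAle eq_sym ne.
  have [ew lv] := pickP w lw hw'; rewrite c_hi //.
  move: (pick w).1 (pick w).2 ew lv => i v ew lv.
  have vw : jlt v w by rewrite ew jlt_shift.
  have hv : (2 * r <= mdeg v.1)%N by move: hw'; rewrite ew mdeg_jshift.
  have [HD De Dt] := extP i (below c i w).
  have HC := genfield_closed e (fun y => exists2 u, param u /\ jlt u w & y = t u).
  apply: (deriv_sep_module (T := tfield (fun x => jlt x w))
    (S := fun y => exists2 u, param u /\ jlt u v & y = t u) HD HC).
  - by move=> x; exact: tfield_e.
  - move=> _ [u [pu uv] ->]; apply: genfield_gen; exists u => //; split=> //.
    exact: jlt_trans uv vw.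
  - by apply: c_below => // lv' _; exact: IH.
  - exact: (fc0 HC).
  - exact: (fcD HC).
  - by move=> x y; exact: (fcM HC).
  - move=> x; rewrite De; apply: tfield_sub (delta_range i x) => u hu.
    by apply: jlt_mdeg; rewrite hu.
  - move=> _ [u [pu uv] ->]; rewrite Dt /below.
    have lt : jlt (jshift i u) w by rewrite ew jlt_shift2.
    by rewrite lt; apply: c_below => // l h; exact: IH.
  - exact/genfield_sep_alg/IH.
(* Q has a variable t_u for every index u; those that are not parameters are made constants. *)
pose uD i u := if excluded_middle_informative (param u) then c (jshift i u) else 0.
pose D i := ext i (uD i).
have DD i : deriv_along idfun (D i) by have [] := extP i (uD i).
have De i x : D i (e x) = delta i x by have [_ De _] := extP i (uD i); exact: De.
have Dt i u : D i (t u) = if excluded_middle_informative (param u) then c (jshift i u) else 0.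
  by have [_ _ Dt] := extP i (uD i); exact: Dt.
have Dpar i u : param u -> D i (t u) = c (jshift i u).
  by rewrite Dt; case: excluded_middle_informative.
have DK i x : D i (eK x) = eK (d i x) by rewrite /= De delta_K.
(* D_i and the provisional derivation agree on F and on the t_u with u below v, hence at c_v. *)
have c_pick w : lead w -> (2 * r < mdeg w.1)%N ->
    exists i v, [/\ w = jshift i v, lead v & D i (c v) = c w].
  move=> lw hw; have [ew lv] := pickP w lw hw; exists (pick w).1, (pick w).2; split=> //.
  rewrite (c_hi w) //; move: (pick w).1 (pick w).2 ew lv => i v ew lv.
  have [HD De' Dt'] := extP i (below c i w).
  have hv : (2 * r <= mdeg v.1)%N by move: hw; rewrite ew mdeg_jshift.
  apply: (deriv_agree (DD i) HD _ _ (c_lead v lv hv)) => [x|_ [u [pu uv] ->]].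
    by rewrite De De'.
  by rewrite Dpar // Dt' /below ew jlt_shift2.
(* Below order 2r this is inherited from the given tuple; from order 2r on, c_w even lies in the
   field generated by the smaller c_v. *)
have c_sep w : lead w -> sep_alg_over eK (fun y => exists2 v, jlt v w & y = c v) (c w).
  move=> lw; case: (ltnP (mdeg w.1) (2 * r)%N) => hw.
    rewrite c_lo //.
    have := @sep_alg_push _ _ _ kappa e eK (fun _ => erefl) _ _ (lead_sep hw lw).
    apply: sep_alg_weaken => _ [_ [u uw ->] ->]; apply: genfield_gen; exists u => //.
    by rewrite c_lo //; apply: leq_ltn_trans hw; exact/jle_mdeg/jltW.
  apply: genfield_sep_alg; have HC := genfield_closed eK (fun y => exists2 v, jlt v w & y = c v).
  move: (c w) (c_lead w lw hw); apply: (genfield_ind (P := in_genfield eK _)) => //.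
    move=> x.
    have := @genfield_push _ _ _ kappa e eK (fun _ => erefl) _ _ (F_gen x).
    apply: genfield_sub => _ [_ [u hu ->] ->]; apply: genfield_gen; exists u.
      by apply: jlt_mdeg; exact: leq_trans hu hw.
    by rewrite c_lo.
  by move=> _ [u [pu uw] ->]; apply: genfield_gen; exists u => //; rewrite c_par.
have Dc w : forall i v, w = jshift i v -> D i (c v) = c w.
  elim/jlt_ind: w => w IH i v ew.
  case: (leqP (mdeg w.1) (2 * r)%N) => hw.
    have hv : (mdeg v.1 < 2 * r)%N by move: hw; rewrite ew mdeg_jshift.
    rewrite c_lo // De; move: hw; rewrite leq_eqVlt => /orP [/eqP hw|hw].
      by rewrite c_mid // ew delta_mid // -hw ew mdeg_jshift.
    by rewrite c_lo // ew delta_lo //; move: hw; rewrite ew mdeg_jshift.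
  have hv : (2 * r <= mdeg v.1)%N by move: hw; rewrite ew mdeg_jshift.
  have [lv|nl] := classic (lead v); last by rewrite c_par // Dpar // ew.
  (* By the induction hypothesis [D_i1, D_i2] vanishes at c_u for all u below z, since u + e_i1 +
     e_i2 is then below w; as c_z is separably algebraic over these, it vanishes at c_z too. *)
  have commute i1 i2 z : w = jshift i1 (jshift i2 z) -> lead z ->
      D i1 (c (jshift i2 z)) = D i2 (c (jshift i1 z)).
    move=> ez lz.
    have lt1 : jlt (jshift i2 z) w by rewrite ez jlt_shift.
    have lt2 : jlt (jshift i1 z) w by rewrite ez jshiftC jlt_shift.
    rewrite -(IH _ lt1 i2 z) // -(IH _ lt2 i1 z) //.
    apply/eqP; rewrite -subr_eq0; apply/eqP.
    apply: (deriv_vanish_sep (deriv_along_commutator (DD i1) (DD i2)) _ _ (c_sep z lz)) => /=.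
      by move=> x; rewrite !DK d_comm subrr.
    move=> _ [u uz ->].
    have lt3 : jlt (jshift i1 (jshift i2 u)) w by rewrite ez; do 2!apply: jlt_shift2.
    have lt4 : jlt (jshift i2 u) w by apply: jlt_trans lt3; exact: jlt_shift.
    have lt5 : jlt (jshift i1 u) w.
      by apply: jlt_trans lt3; rewrite jshiftC; exact: jlt_shift.
    rewrite (IH _ lt4 i2 u) // (IH _ lt5 i1 u) // (IH _ lt3 i1) //.
    by rewrite (IH _ lt3 i2) ?subrr // jshiftC.
  have lw : lead w by rewrite ew; exact: lead_shift.
  (* It remains to compare the given way of reaching w, through v, with the chosen one, through
     v'. *)
  have [l [v' [ew' lv' <-]]] := c_pick w lw hw.
  case: (eqVneq i l) => [eil|il].
    by move: ew'; rewrite ew eil => /jshift_inj ->.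
  case: v v' w ew ew' lv lv' hw hv commute {IH lw} => [x k] [x' k'] [y k''] /=.
  move=> e1 e2; have ek : k'' = k := congr1 snd e1; have ek' : k'' = k' := congr1 snd e2.
  have ey : y = (x + U_(i))%MM := congr1 fst e1; have ey' : y = (x' + U_(l))%MM := congr1 fst e2.
  subst k' k'' y => -[rho h1 b1] [rho' h2 b2] /= hw hv commute.
  rewrite /= in h1 h2 b1 b2.
  have [z [ex ex' hz]] := mnm_diamond il ey'.
  have [lz|nz] := classic (lead (z, k)).
    have := commute i l (z, k); rewrite /jshift /= -ex -ex'; apply=> //.
  (* The lcm of the two leaders has order at most 2r, less than that of w, so one can step down from
     w to an index u still above both. *)
  have [||j [u [eu hu]]] := @mnm_room _ (mlcm rho rho') (x + U_(i))%MM.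
  - rewrite lem_mlcm (lepm_trans h1 (lem_addr _ _)) ey'.
    by rewrite (lepm_trans h2 (lem_addr _ _)).
  - apply: leq_ltn_trans hw; apply: leq_trans (mdeg_mlcm _ _) _.
    by have := base_le b1; have := base_le b2; rewrite /=; lia.
  move: hu; rewrite lem_mlcm => /andP [hu1 hu2].
  (* If j were i, then u would be x, and rho' would lie below both x and x', hence below z, which is
     not a lead. The case of l is symmetric, with rho. *)
  have ij : i != j.
    apply/eqP => eij; move: eu; rewrite eij => /addIm exu; subst u.
    by apply: nz; exists rho' => //=; exact: hz.
  have lj : l != j.
    apply/eqP => elj; move: eu; rewrite ey' elj => /addIm exu; subst u.
    by apply: nz; exists rho => //=; exact: hz.
  have [z1 [ex1 eu1 hz1]] := mnm_diamond ij eu.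
  have [z2 [ex2 eu2 hz2]] := mnm_diamond lj (etrans (esym ey') eu).
  (* Both comparisons now pass through a lead: z1 is above rho, which is below x and u, and z2 is
     above rho', which is below x' and u. *)
  transitivity (D j (c (u, k))).
    have := commute i j (z1, k); rewrite /jshift /= -ex1 -eu1; apply=> //.
    by exists rho => //=; exact: hz1.
  have := commute l j (z2, k); rewrite /jshift /= -ex2 -eu2 => -> //.
  by exists rho' => //=; exact: hz2.
exists D, c; split=> //; last by move=> i v; exact: Dc.
split=> [i|i l x].
  by have [h1 h2] := DD i; split=> // x y; rewrite h2.
apply/eqP; rewrite -subr_eq0; apply/eqP.
have Dcomm := deriv_along_commutator (DD i) (DD l).
(* The commutator is checked on generators: K, the alpha_v of order below 2r, the parameters t_v =
   c_v, and the remaining t_v, which are constants. *)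
apply: (deriv_vanish_gen Dcomm _ _ (Q_gen x)) => [y|_ [v ->]].
  have De2 : deriv_along e (fun y => D i (D l (e y)) - D l (D i (e y))).
    by have [h1 h2] := Dcomm; split=> u v; rewrite ?rmorphD ?rmorphM ?h1 ?h2.
  apply: (deriv_vanish_gen De2 _ _ (F_gen y)) => [z|_ [v hv ->]].
    by have := DK; rewrite /= => DK'; rewrite !DK' d_comm subrr.
  by rewrite -c_lo // !(Dc _ _ _ erefl) jshiftC subrr.
have [pv|npv] := classic (param v).
  by rewrite -c_par // !(Dc _ _ _ erefl) jshiftC subrr.
have D0 i1 : D i1 (t v) = 0 by rewrite Dt; case: excluded_middle_informative.
by rewrite !D0 !(dal0 (DD _)) subrr.
Qed.
End Prolongation.

(** * The top level *)

Section TopLevel.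
Variables (m n r : nat) (i0 : 'I_m) (K F L Q : fieldType) (d : 'I_m -> K -> K).
Notation J := ('X_{1..m} * 'I_n)%type.
Variables (kappa : {rmorphism K -> F}) (j : {rmorphism F -> L}) (iota : {rmorphism K -> L}).
Variables (a : J -> L) (alpha : J -> F) (delta : 'I_m -> F -> L).
Variables (e : {rmorphism F -> Q}) (t : J -> Q).

Hypothesis r_gt0 : (0 < r)%N.
Hypothesis d_comm : forall i l x, d i (d l x) = d l (d i x).
Hypothesis jk : forall c, j (kappa c) = iota c.
Hypothesis ja : forall v, (mdeg v.1 < 2 * r)%N -> j (alpha v) = a v.
Hypothesis F_gen : forall x,
  in_genfield kappa (fun y => exists2 v, (mdeg v.1 < 2 * r)%N & y = alpha v) x.
Hypothesis delta_deriv : forall i, deriv_along j (delta i).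
Hypothesis delta_K : forall i c, delta i (kappa c) = iota (d i c).
Hypothesis delta_a : forall i v, (mdeg v.1 < 2 * r)%N -> delta i (alpha v) = a (jshift i v).

Definition low_leader (w : J) := (mdeg w.1 <= r)%N /\ jlead iota a w.
Notation lead := (lead low_leader).
Hypothesis lead_low : forall w, (mdeg w.1 <= 2 * r)%N -> jlead iota a w -> lead w.

Lemma jlead_pull w : (mdeg w.1 < 2 * r)%N -> jlead iota a w ->
  sep_alg_over kappa (fun y => exists2 v, jlt v w & y = alpha v) (alpha w).
Proof.
move=> hw; rewrite /jlead -ja // => h.
have lo v : jlt v w -> (mdeg v.1 < 2 * r)%N.
  by move=> /jltW /jle_mdeg h'; exact: leq_ltn_trans h' hw.
apply: sep_alg_weaken (sep_alg_pull jk _ h) => [s [v hv e1]|_ [v hv ->]].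
  by apply: genfield_gen; exists v => //; apply: (fmorph_inj j); rewrite e1 ja ?lo.
by exists (alpha v); rewrite ja ?lo.
Qed.

(** Differentiating the separable equation of a_v expresses its derivative rationally through a_v,
    the smaller a_u and the derivatives of the latter, all of index below v + e_i. *)
Lemma jlead_shift i v : (mdeg v.1 < 2 * r)%N -> jlead iota a v -> jlead iota a (jshift i v).
Proof.
move=> hv lv; apply: genfield_sep_alg; rewrite -delta_a //.
pose G := in_genfield iota (fun y => exists2 u, jlt u (jshift i v) & y = a u).
have HG : field_closed G by exact: genfield_closed.
have lo u : jlt u v -> (mdeg u.1 < 2 * r)%N.
  by move=> /jltW /jle_mdeg h'; exact: leq_ltn_trans h' hv.
have lt u : jlt u v -> jlt u (jshift i v) by move=> h; exact: jlt_trans h (jlt_shift _ _).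
apply: (deriv_sep_module (W := G) (T := fun x => G (j x)) (delta_deriv i) _ _ _ _ _ _ _ _ _
  (jlead_pull hv lv)).
- split=> [|x y hx hy|x y hx hy].
  + by rewrite rmorph1; exact: (fc1 HG).
  + by rewrite rmorphB; exact: (fcB HG).
  + by rewrite fmorph_div; exact: (fc_div HG).
- by move=> c; rewrite jk; exact: genfield_const.
- by move=> _ [u uv ->]; rewrite ja ?lo //; apply: genfield_gen; exists u => //; exact: lt.
- by rewrite ja //; apply: genfield_gen; exists v => //; exact: jlt_shift.
- exact: (fc0 HG).
- by move=> x y; exact: (fcD HG).
- by move=> x y; exact: (fcM HG).
- by move=> c; rewrite delta_K; exact: genfield_const.
- move=> _ [u uv ->]; rewrite delta_a ?lo //; apply: genfield_gen.
  by exists (jshift i u) => //; exact: jlt_shift2.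
Qed.

Lemma lead_jlead w : (mdeg w.1 <= 2 * r)%N -> lead w -> jlead iota a w.
Proof.
case: w => x k /= hx [rho /= le [_ l]].
suff H y : (mdeg (rho + y)%MM <= 2 * r)%N -> jlead iota a ((rho + y)%MM, k).
  by rewrite -(submK le) addmC; apply: H; rewrite addmC submK.
elim/mnm_ind: y => [|i y IH]; first by rewrite addm0.
rewrite addmA => h; rewrite mdegD mdeg1 addn1 in h.
by apply: (@jlead_shift i ((rho + y)%MM, k)) => //; apply: IH; exact: ltnW.
Qed.

Definition top (w : J) := mdeg w.1 = (2 * r)%N /\ ~ lead w.

(* The graph of the F-linear map from the F-span of 1 and the a_v, v in B, to Q
   sending 1 to 1 and a_v to t_v. *)
Inductive lin (B : J -> Prop) : L -> Q -> Prop :=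
| Lin0 c : lin B (j c) (e c)
| LinS c v y z : B v -> lin B y z -> lin B (j c * a v + y) (e c * t v + z).

Lemma lin_mono (B B' : J -> Prop) y z : (forall v, B v -> B' v) -> lin B y z -> lin B' y z.
Proof.
move=> h; elim=> [c|c v y' z' Bv _ IH]; first exact: Lin0.
by apply: LinS => //; exact: h.
Qed.

Lemma linD B y z y' z' : lin B y z -> lin B y' z' -> lin B (y + y') (z + z').
Proof.
elim=> [c|c v u w Bv _ IH] h; last by rewrite -!addrA; apply: LinS => //; exact: IH.
elim: h => [c'|c' v u w Bv _ IH]; first by rewrite -!rmorphD; exact: Lin0.
by rewrite ![_ + (_ * _ + _)]addrCA; apply: LinS.
Qed.

Lemma linZ B c y z : lin B y z -> lin B (j c * y) (e c * z).
Proof.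
elim=> [c'|c' v u w Bv _ IH]; first by rewrite -!rmorphM; exact: Lin0.
by rewrite !mulrDr !mulrA -!rmorphM; exact: LinS.
Qed.

Lemma lin_gen w y z : lin (fun v => top v /\ jlt v w) y z -> (2 * r <= mdeg w.1)%N ->
  in_genfield iota (fun y => exists2 v, jlt v w & y = a v) y.
Proof.
move=> h hw; have HG := genfield_closed iota (fun y => exists2 v, jlt v w & y = a v).
have hj x : in_genfield iota (fun y => exists2 v, jlt v w & y = a v) (j x).
  have := genfield_push jk (F_gen x); apply: genfield_sub => _ [_ [v hv ->] ->].
  by apply: genfield_gen; exists v; rewrite ?ja //; apply: jlt_mdeg; exact: leq_trans hv hw.
elim: h => [c|c v y' z' [_ vw] _ IH]; first exact: hj.
by apply: (fcD HG) => //; apply: (fcM HG) => //; apply: genfield_gen; exists v.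
Qed.

Lemma lin_split w y z : top w -> lin (fun v => top v /\ jle v w) y z ->
  exists c y' z', [/\ y = j c * a w + y', z = e c * t w + z' &
    lin (fun v => top v /\ jlt v w) y' z'].
Proof.
move=> tw; elim=> [c|c v y' z' [tv vw] _ [c' [y1 [z1 [-> -> h]]]]].
  by exists 0, (j c), (e c); rewrite !rmorph0 !mul0r !add0r; split=> //; exact: Lin0.
move: vw; rewrite jle_eqVlt => /orP [/eqP ->|vw].
  by exists (c + c'), y1, z1; rewrite !rmorphD !mulrDl !addrA.
exists c', (j c * a v + y1), (e c * t v + z1); split; [ring|ring|exact: LinS].
Qed.

(** The order is total, so a combination involving some generator of order 2r has a greatest index;
    it starts the descent in [lin0]. *)
Lemma lin_bound B y z : lin (fun v => top v /\ B v) y z ->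
  (exists2 c, y = j c & z = e c) \/
  exists w, [/\ top w, B w & lin (fun v => top v /\ jle v w) y z].
Proof.
elim=> [c|c v y' z' [tv Bv] _ [[c' -> ->]|[w [tw Bw h]]]]; first by left; exists c.
  right; exists v; split=> //; apply: LinS; first by split=> //; exact: jle_refl.
  exact: Lin0.
right; case: (boolP (jle v w)) => vw; first by exists w; split=> //; exact: LinS.
have wv : jle w v by apply: jltW; rewrite jltNge.
exists v; split=> //; apply: LinS; first by split=> //; exact: jle_refl.
by apply: lin_mono h => u [tu uw]; split=> //; exact: jle_trans uw wv.
Qed.

(** If the coefficient at the greatest index w were nonzero, a_w would lie in the field generated by
    the smaller generators, so w would be a separable leader and thus a lead. Hence it is 0, and the
    relation descends to a smaller greatest index. This is the well-definedness of the F-linear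
    map. *)
Lemma lin0 z : lin top 0 z -> z = 0.
Proof.
move=> h; have {h} h : lin (fun v => top v /\ True) 0 z by apply: lin_mono h.
have base c : 0 = j c -> e c = 0.
  by move=> /esym /eqP; rewrite fmorph_eq0 => /eqP ->; rewrite rmorph0.
case: (lin_bound h) => [[c /base h0 ->] //|[w [tw _ {}h]]].
elim/jlt_ind: w z tw h => w IH z tw h.
have [c [y' [z' [e1 -> h']]]] := lin_split tw h.
have c0 : c = 0.
  apply/eqP; apply: contraPT isT => c0 _; case: (tw) => dw; apply; apply: lead_low.
    by rewrite dw.
  apply: genfield_sep_alg.
  have -> : a w = j (- c^-1) * y'.
    apply: (mulfI (_ : j c != 0)); first by rewrite fmorph_eq0.
    rewrite mulrA -rmorphM mulrN divff // rmorphN1 mulN1r.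
    by apply/eqP; rewrite -addr_eq0 -e1.
  by apply: lin_gen (linZ (- c^-1) h') _; rewrite dw.
move: e1; rewrite c0 !rmorph0 !mul0r !add0r => e1; rewrite -e1 in h'.
have [[c' /base h0 -> //]|[w' [tw' lt h'']]] := lin_bound h'.
exact: IH lt _ tw' h''.
Qed.

Lemma lin_uniq y z z' : lin top y z -> lin top y z' -> z = z'.
Proof.
move=> h /(linZ (-1)) h'; apply/eqP; rewrite -subr_eq0; apply/eqP/lin0.
by have := linD h h'; rewrite !rmorphN1 !mulN1r subrr.
Qed.

(** The domain of the linear map is an F-subspace of L containing F, so it can serve as W in
    [deriv_sep_module]. *)
Lemma lin_deriv i x (P : J -> Prop) (S : F -> Prop) :
  sep_alg_over kappa S x ->
  (forall s, S s -> exists z, lin (fun v => top v /\ P v) (delta i s) z) ->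
  exists z, lin (fun v => top v /\ P v) (delta i x) z.
Proof.
move=> hx hS; pose B v := top v /\ P v.
apply: (deriv_sep_module (W := fun y => exists z, lin B y z) (T := fun _ => True)
  (delta_deriv i) _ _ _ _ _ _ _ _ _ hx) => //.
- by exists (e 0); rewrite -(rmorph0 j); exact: Lin0.
- by move=> u v [z hz] [z' hz']; exists (z + z'); exact: linD.
- by move=> c u _ [z hz]; exists (e c * z); exact: linZ.
- by move=> c; rewrite delta_K -jk; exists (e (kappa (d i c))); exact: Lin0.
Qed.

(** A lead w of order 2r is v + e_i for a lead v, since r < 2r. As a_v is separably algebraic over
    the smaller a_u, its derivative a_w is an affine combination over F of the a at u + e_i, which
    are below w and fall under induction. *)
Lemma lin_top w : mdeg w.1 = (2 * r)%N -> exists z,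
  lin (fun v => top v /\ jle v w) (a w) z /\
  (lead w -> lin (fun v => top v /\ jlt v w) (a w) z).
Proof.
elim/jlt_ind: w => w IH dw.
have [lw|nl] := classic (lead w); last first.
  exists (e 1 * t w + e 0); split=> //.
  rewrite -[a w]mul1r -[1 * a w]addr0 -(rmorph1 j) -(rmorph0 j).
  by apply: LinS; [split; [|exact: jle_refl]|exact: Lin0].
have [||i [v [ew lv]]] := @lead_pred _ _ r low_leader _ w lw.
- by move=> u [].
- by rewrite dw; lia.
have dv : (mdeg v.1 < 2 * r)%N by rewrite -dw ew mdeg_jshift.
have jlv : jlead iota a v by apply: lead_jlead => //; exact: ltnW.
have [|z hz] := lin_deriv (i := i) (P := fun u => jlt u w) (jlead_pull dv jlv).
  move=> _ [u uv ->].
  have du : (mdeg u.1 < 2 * r)%N by apply: leq_ltn_trans dv; exact/jle_mdeg/jltW.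
  have uw : jlt (jshift i u) w by rewrite ew; exact: jlt_shift2.
  rewrite delta_a //; move: (du); rewrite -(mdeg_jshift i u) leq_eqVlt => /orP [/eqP h|h].
    have [z [hz _]] := IH _ uw h; exists z; apply: lin_mono hz => x [tx xu].
    by split=> //; exact: jle_lt_trans xu uw.
  by rewrite -ja //; exists (e (alpha (jshift i u))); exact: Lin0.
exists z; rewrite delta_a // -ew in hz; split=> //.
by apply: lin_mono hz => x [tx xw]; split=> //; exact: jltW.
Qed.

Lemma lin_tfield (B : J -> Prop) y z : lin (fun v => top v /\ B v) y z ->
  tfield r e t low_leader (fun v => B v /\ mdeg v.1 = (2 * r)%N) z.
Proof.
have HG := genfield_closed e (fun y => exists2 u,
  param r low_leader u /\ (B u /\ mdeg u.1 = (2 * r)%N) & y = t u).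
elim=> [c|c v y' z' [[dv nl] Bv] _ IH]; first exact: genfield_const.
apply: (fcD HG) => //; apply: (fcM HG); first exact: genfield_const.
by apply: genfield_gen; exists v => //; split=> //; split=> //; rewrite dv.
Qed.

Hypothesis Q_gen : forall x, in_genfield e (fun y => exists v, y = t v) x.
Hypothesis Q_ext : forall (del : F -> Q) (u : J -> Q), deriv_along e del ->
  exists D : Q -> Q, [/\ deriv_along idfun D,
    forall x, D (e x) = del x & forall v, D (t v) = u v].

Lemma differential_extension : exists (D : 'I_m -> Q -> Q) (c : J -> Q),
  [/\ commuting_derivations D, forall i x, D i (e (kappa x)) = e (kappa (d i x)),
      forall v, (mdeg v.1 < 2 * r)%N -> c v = e (alpha v)
    & forall i v, D i (c v) = c (jshift i v)].
Proof.
have [c2 c2P] : exists c2 : J -> Q, forall w, mdeg w.1 = (2 * r)%N ->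
    lin (fun v => top v /\ jle v w) (a w) (c2 w) /\
    (lead w -> lin (fun v => top v /\ jlt v w) (a w) (c2 w)).
  apply: (choice_fun (R := fun w z => mdeg w.1 = (2 * r)%N ->
    lin (fun v => top v /\ jle v w) (a w) z /\
    (lead w -> lin (fun v => top v /\ jlt v w) (a w) z))) => w.
  case: (eqVneq (mdeg w.1) (2 * r)%N) => [h|/eqP h]; last by exists 0 => /h.
  by have [z hz] := lin_top h; exists z.
have c2T w : mdeg w.1 = (2 * r)%N -> lin top (a w) (c2 w).
  by move=> /c2P [h _]; apply: lin_mono h => v [].
have lin_shift i v : (mdeg v.1 < 2 * r)%N -> exists z, lin top (a (jshift i v)) z.
  rewrite -(mdeg_jshift i v) leq_eqVlt => /orP [/eqP h|h].
    by exists (c2 (jshift i v)); exact: c2T.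
  by rewrite -ja //; exists (e (alpha (jshift i v))); exact: Lin0.
(* The derivation F -> L followed by the linear map into Q. Linearity over F makes the composite a
   derivation again. *)
have [del delP] : exists del : 'I_m -> F -> Q, forall i x, lin top (delta i x) (del i x).
  have [|f fP] := choice_fun (R := fun (p : 'I_m * F) z => lin top (delta p.1 p.2) z); last first.
    by exists (fun i x => f (i, x)) => i x; exact: (fP (i, x)).
  move=> [i x] /=.
  have [|z hz] := lin_deriv (i := i) (P := fun _ => True) (genfield_sep_alg (F_gen x)).
    move=> _ [v dv ->]; rewrite delta_a //; have [z hz] := lin_shift i v dv.
    by exists z; apply: lin_mono hz.
  by exists z; apply: lin_mono hz => v [].
have del_uniq i x z : lin top (delta i x) z -> del i x = z by move=> h; exact: lin_uniq h.
apply: (@prolongation m n r i0 K F Q d kappa alpha e t low_leader del c2) => //.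
- by move=> w [].
- move=> i; split=> x y; apply: del_uniq.
    by rewrite (dalD (delta_deriv i)); exact: linD.
  rewrite (dalM (delta_deriv i)) addrC [_ * j y]mulrC [_ * e y]mulrC [X in lin _ _ X]addrC.
  by apply: linD; exact: linZ.
- by move=> i x; apply: del_uniq; rewrite delta_K -jk; exact: Lin0.
- move=> i v dv; apply: del_uniq; rewrite delta_a ?(ltnW dv) //.
  by rewrite -ja ?mdeg_jshift //; exact: Lin0.
- by move=> i v dv; apply: del_uniq; rewrite delta_a -?dv //; apply: c2T; rewrite mdeg_jshift.
- move=> i x; have h : lin (fun v => top v /\ True) (delta i x) (del i x).
    by apply: lin_mono (delP i x).
  by apply: tfield_sub (lin_tfield h) => u [].
- move=> w dw lw; have [_ /(_ lw) h] := c2P w dw.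
  by apply: tfield_sub (lin_tfield h) => u [].
- move=> w dw nl; apply: lin_uniq (c2T w dw) _.
  rewrite -[a w]mul1r -[1 * a w]addr0 -[t w]mul1r -[1 * t w]addr0.
  by rewrite -{1}(rmorph1 j) -(rmorph0 j) -{1}(rmorph1 e) -(rmorph0 e); apply: LinS => //; exact: Lin0.
- by move=> w dw lw; apply: jlead_pull => //; apply: lead_jlead => //; exact: ltnW.
Qed.
End TopLevel.

(** * From existential closedness to specializations *)

Lemma rmorphism_lift (K F L : fieldType) (j : {rmorphism F -> L}) (iota : {rmorphism K -> L}) :
  (forall c, exists x, j x = iota c) ->
  exists kappa : {rmorphism K -> F}, forall c, j (kappa c) = iota c.
Proof.
move=> h; have [k kP] := choice_fun h.
have kB : zmod_morphism k.
  by move=> x y; apply: (fmorph_inj j); rewrite rmorphB !kP rmorphB.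
have kM : monoid_morphism k.
  by split=> [|x y]; apply: (fmorph_inj j); rewrite ?rmorph1 ?rmorphM !kP ?rmorph1 ?rmorphM.
pose kz := GRing.isZmodMorphism.Build K F k kB.
pose km := GRing.isMonoidMorphism.Build K F k kM.
pose kr : {rmorphism K -> F} := HB.pack k kz km.
by exists kr.
Qed.

Lemma mmap_rmorph (K F L : fieldType) N (kappa : {rmorphism K -> F}) (phi : {rmorphism F -> L})
    (iota : {rmorphism K -> L}) (h : 'I_N -> F) f : (forall c, phi (kappa c) = iota c) ->
  phi (mmap kappa h f) = mmap iota (fun k => phi (h k)) f.
Proof.
move=> pk; rewrite rmorph_sum; apply: eq_bigr => x _; rewrite rmorphM pk; congr (_ * _).
by rewrite /mmap1 rmorph_prod; apply: eq_bigr => k _; rewrite rmorphXn.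
Qed.

Section DerivedField.
Variables (m n r : nat) (K L : fieldType) (d : 'I_m -> K -> K) (iota : {rmorphism K -> L}).
Notation J := ('X_{1..m} * 'I_n)%type.
Variable a : Idx m r n -> L.
Definition aJ (w : J) : L := a (j_to_idx r w).

Lemma aJ_idx v : aJ (idx_to_j v) = a v. Proof. by rewrite /aJ idx_to_jK. Qed.

(** Induction on the order: a leader that is not minimal lies above another one of strictly smaller
    order, and a minimal one has order at most r. *)
Lemma min_leader_low : (forall s : Idx m r n, (absx s.1 <= 2 * r)%N ->
    min_sep_leader iota a s -> (absx s.1 <= r)%N) ->
  forall w : J, (mdeg w.1 <= 2 * r)%N -> jlead iota aJ w -> lead (low_leader r iota aJ) w.
Proof.
move=> Hmin [x k] /=; have [N] := ubnP (mdeg x); elim: N x => // N IH x hN hx lx.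
have aE v : (absx v.1 <= 2 * r)%N -> a v = aJ (idx_to_j v) by rewrite aJ_idx.
pose s : Idx m r n := j_to_idx r (x, k).
have es : idx_to_j s = (x, k) by exact: j_to_idxK.
have ds : absx s.1 = mdeg x by rewrite -mdeg_idx es.
have [mn|nm] := classic (min_sep_leader iota a s).
  exists x; first exact: lepm_refl.
  by split=> //=; rewrite -ds; apply: Hmin; rewrite ?ds.
have ls : sep_leader iota a s by apply/(sep_leaderE _ aE); rewrite ?ds // es.
have [rho [le ne lrho]] : exists rho : {ffun 'I_m -> 'I_(2 * r).+1},
    [/\ (forall i, (rho i <= s.1 i)%N), rho != s.1 & sep_leader iota a (rho, s.2)].
  apply: NNPP => h; apply: nm; split=> // rho h1 h2 h3; apply: h.
  by exists rho.
set y := (idx_to_j (rho, s.2)).1.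
have dy : mdeg y = absx rho by exact: mdeg_idx.
have lt : (absx rho < absx s.1)%N.
  have [i hi] : exists i, (rho i < s.1 i)%N.
    apply: NNPP => h; case/eqP: ne; apply/ffunP => i; apply/val_inj/eqP.
    by rewrite eqn_leq le leqNgt; apply/negP => h'; apply: h; exists i.
  rewrite /absx (bigD1 i) //= [ltnRHS](bigD1 i) //= -addSn.
  by apply: leq_add => //; apply: leq_sum.
have dy2 : (mdeg y <= 2 * r)%N by rewrite dy; lia.
have [||rho' le' b'] := IH y _ dy2.
- by rewrite dy; lia.
- by apply: (sep_leaderE iota (s := (rho, s.2)) aE _).1 lrho; rewrite /=; lia.
exists rho' => //; apply: lepm_trans le' _; apply/mnm_lepP => i.
have := le i; rewrite mnmE ffunE /= inordK // ltnS.
by apply: leq_trans hx; rewrite mdegE (bigD1 i) //= leq_addr.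
Qed.
Hypothesis Hd : forall i, derivation (d i).
Hypotheses (m_gt0 : (0 < m)%N) (n_gt0 : (0 < n)%N) (r_gt0 : (0 < r)%N).
Hypothesis a_diff : diff_condition d iota a.

Lemma diff_condition_total i (f : IPoly K m r n) : ord_poly (2 * r).-1 f ->
  evalI iota a f = 0 ->
  total_deriv iota (d i) (fun k => a (enum_val k)) (fun k => a (ishift i (enum_val k))) f = 0.
Proof.
move=> hf ef; have [s [ds hs]] := idx_max r_gt0 n_gt0 m_gt0.
have fv : vars_in (fun v => (absx v.1 < 2 * r)%N) f.
  by apply: ord_poly_vars hf; lia.
have fv' : vars_in (fun v => ile v s) f.
  move=> x hx k nk; apply: (fv x hx); apply: contra nk; exact: hs.
apply: etrans (a_diff i (s := s) _ fv' ef); last by rewrite ds.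
congr (_ + _); rewrite [LHS](reindex enum_rank) /=; last first.
  by exists enum_val => k _; rewrite ?enum_rankK ?enum_valK.
rewrite [RHS]big_mkcond /=; apply: eq_bigr => v _; rewrite enum_rankK.
case: ifP => // hv; rewrite mderiv_unused ?mmap0 ?mul0r // => x hx.
by apply: (fv' x hx); rewrite enum_rankK hv.
Qed.

(** The graph of the i-th derivation consists of the pairs of f(a) and the total derivative of f at
    a, for f of order below 2r. The differential condition says precisely that f(a) = 0 forces the
    second entry to be 0, as [deriv_from_graph] requires. *)
Lemma derived_field : exists (F : fieldType) (j : {rmorphism F -> L})
    (kappa : {rmorphism K -> F}) (alpha : J -> F) (delta : 'I_m -> F -> L),
  [/\ forall c, j (kappa c) = iota c,
      forall v, (mdeg v.1 < 2 * r)%N -> j (alpha v) = aJ v,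
      forall x, in_genfield kappa (fun y => exists2 v, (mdeg v.1 < 2 * r)%N & y = alpha v) x,
      forall i, deriv_along j (delta i)
    & (forall i c, delta i (kappa c) = iota (d i c)) /\
      forall i v, (mdeg v.1 < 2 * r)%N -> delta i (alpha v) = aJ (jshift i v)].
Proof.
pose S y := exists2 v : J, (mdeg v.1 < 2 * r)%N & y = aJ v.
have [F [j jP]] := field_closed_subfield (genfield_closed iota S).
have [|kappa jk] := @rmorphism_lift K F L j iota.
  by move=> c; apply/jP; exact: genfield_const.
have [alpha ja] : exists alpha : J -> F, forall v, (mdeg v.1 < 2 * r)%N -> j (alpha v) = aJ v.
  apply: (choice_fun (R := fun (v : J) x => (mdeg v.1 < 2 * r)%N -> j x = aJ v)) => v.
  case: (ltnP (mdeg v.1) (2 * r)%N) => hv; last by exists 0.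
  have [|x hx] := (jP (aJ v)).1; last by exists x.
  by apply: genfield_gen; exists v.
pose P (f : IPoly K m r n) := ord_poly (2 * r).-1 f.
pose T i (f : IPoly K m r n) :=
  total_deriv iota (d i) (fun k => a (enum_val k)) (fun k => a (ishift i (enum_val k))) f.
have PB f g : P f -> P g -> P (f - g).
  move=> hf hg; rewrite -[- g]scaleN1r -mul_mpolyC; apply: OrdD => //.
  by apply: OrdM => //; exact: OrdC.
have TB i (f g : IPoly K m r n) : T i (f - g) = T i f - T i g.
  by apply: (addIr (T i g)); rewrite /T -(total_derivD _ (Hd i)) !subrK.
have evB (f g : IPoly K m r n) : evalI iota a (f - g) = evalI iota a f - evalI iota a g by exact: mmapB.
have evM (f g : IPoly K m r n) : evalI iota a (f * g) = evalI iota a f * evalI iota a g by exact: rmorphM.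
pose G i x x' := exists2 f, P f & x = evalI iota a f /\ x' = T i f.
have fracE y : in_genfield iota S y ->
    exists f g, [/\ P f, P g, evalI iota a g != 0 & y = evalI iota a f / evalI iota a g].
  have ev1 : evalI iota a 1%:MP = 1 by exact: (rmorph1 (mmap iota _)).
  move: y; apply: (genfield_ind (P := fun y => exists f g,
    [/\ P f, P g, evalI iota a g != 0 & y = evalI iota a f / evalI iota a g])).
  - split.
    + exists 1%:MP, 1%:MP; rewrite ev1 divr1 oner_eq0; split=> //; exact: OrdC.
    + move=> _ _ [f [g [Pf Pg g0 ->]]] [f' [g' [Pf' Pg' g0' ->]]].
      exists (f * g' - f' * g), (g * g'); split.
      * by apply: PB; exact: OrdM.
      * exact: OrdM.
      * by rewrite evM mulf_neq0.
      * by rewrite evB !evM; field; rewrite g0 g0'.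
    + move=> _ _ [f [g [Pf Pg g0 ->]]] [f' [g' [Pf' Pg' g0' ->]]].
      (* Closure under quotients includes division by 0, whose value is 0 by convention; it is
         represented as 0/1. *)
      have [f0|f0] := eqVneq (evalI iota a f') 0.
        exists 0%:MP, 1%:MP; rewrite ev1 f0 mul0r invr0 mulr0 divr1 oner_eq0.
        by split; [exact: OrdC|exact: OrdC|by []|rewrite /evalI mmapC; exact: (esym (rmorph0 iota))].
      exists (f * g'), (g * f'); split; [exact: OrdM|exact: OrdM|by rewrite evM mulf_neq0|].
      by rewrite !evM; field; rewrite g0 g0' f0.
  - move=> c; exists c%:MP, 1%:MP; rewrite ev1 divr1 oner_eq0 /evalI mmapC.
    by split=> //; exact: OrdC.
  - move=> _ [v hv ->]; exists 'X_(enum_rank (j_to_idx r v)), 1%:MP.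
    rewrite ev1 divr1 oner_eq0 /evalI mmapX mmap1U enum_rankK; split=> //; last exact: OrdC.
    by apply: OrdX; rewrite -mdeg_idx j_to_idxK; lia.
have [delta deltaP] : exists delta : 'I_m -> F -> L, forall i,
    deriv_along j (delta i) /\ forall x x', G i (j x) x' -> delta i x = x'.
  apply: (choice_fun (R := fun i D => deriv_along j D /\ forall x x', G i (j x) x' -> D x = x')).
  move=> i; apply: deriv_from_graph.
  - move=> _ _ _ _ [f Pf [-> ->]] [g Pg [-> ->]]; exists (f - g); first exact: PB.
    by rewrite evB TB.
  - move=> _ _ _ _ [f Pf [-> ->]] [g Pg [-> ->]]; exists (f * g); first exact: OrdM.
    by rewrite evM; split=> //; exact: (esym (total_derivM iota (Hd i) _ _ f g)).
  - by move=> x' [f Pf [/esym ef ->]]; exact: diff_condition_total.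
  - move=> x; have [|f [g [Pf Pg g0 e1]]] := fracE (j x).
      by apply/jP; exists x.
    exists (evalI iota a f), (T i f), (evalI iota a g), (T i g).
    by split=> //; [exists f|exists g].
exists F, j, kappa, alpha, delta; split=> //.
- move=> x; have [||x1 ex hx1] := genfield_pull (iota := iota) (j := j) jk (S := S) (y := j x).
  + by move=> s [v hv ->]; exists (alpha v); rewrite ja.
  + by apply/jP; exists x.
  + rewrite (fmorph_inj j ex); apply: genfield_sub hx1 => s [v hv es].
    by apply: genfield_gen; exists v => //; apply: (fmorph_inj j); rewrite ja.
- by move=> i; case: (deltaP i).
- split=> [i c|i v hv]; apply: (deltaP i).2.
    by exists c%:MP; [exact: OrdC|rewrite jk /evalI mmapC /T total_derivC].
  exists 'X_(enum_rank (j_to_idx r v)).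
    by apply: OrdX; rewrite -mdeg_idx j_to_idxK; lia.
  rewrite ja // /evalI mmapX mmap1U /T total_derivX // enum_rankK; split=> //.
  have hv' : (mdeg v.1 <= 2 * r)%N by exact: ltnW.
  rewrite -aJ_idx idx_shift ?j_to_idxK //.
  by rewrite -mdeg_idx j_to_idxK.
Qed.

End DerivedField.

Section PolynomialTerms.
Variables (m n : nat) (K : fieldType).

Lemma deval_dpow (L : fieldType) dL (iota : K -> L) (y : 'I_n -> L) (xi : 'I_m -> nat) t :
  deval iota dL y (dpow (fun i => @DDer m n K i) xi t) = dpow dL xi (deval iota dL y t).
Proof.
rewrite /dpow; elim: (enum _) => //= i s IH.
by elim: (xi i) => //= k ->.
Qed.

(** The same term works for every extension, so a solution in Q and one in K concern the same
    equations. *)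
Lemma mpoly_dterm N (g : 'I_N -> dterm m n K) (f : {mpoly K[N]}) :
  exists T : dterm m n K, forall (L : fieldType) dL (iota : {rmorphism K -> L}) y,
    deval iota dL y T = mmap iota (fun k => deval iota dL y (g k)) f.
Proof.
pose P (f : {mpoly K[N]}) := exists T : dterm m n K,
  forall (L : fieldType) dL (iota : {rmorphism K -> L}) y,
    deval iota dL y T = mmap iota (fun k => deval iota dL y (g k)) f.
have PC c : P c%:MP by exists (DConst _ _ c) => L dL iota y; rewrite mmapC.
have PM f1 f2 : P f1 -> P f2 -> P (f1 * f2).
  move=> [T1 h1] [T2 h2]; exists (DMul T1 T2) => L dL iota y.
  by rewrite /= h1 h2 (rmorphM (mmap iota _)).
have PX k : P 'X_k by exists (g k) => L dL iota y; rewrite mmapX mmap1U.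
rewrite -/(P f); elim/mpoly_additive_ind: f => [|c x|f1 f2 [T1 h1] [T2 h2]].
- by rewrite -mpolyC0.
- rewrite -mul_mpolyC; apply: (PM) => //; rewrite mpolyXE_id.
  apply: big_ind => [||k _]; [by rewrite -mpolyC1|exact: PM|].
  by elim: (x k) => [|l IH]; [rewrite expr0 -mpolyC1|rewrite exprS; exact: PM].
- by exists (DAdd T1 T2) => L dL iota y; rewrite /= h1 h2 mmapD.
Qed.
End PolynomialTerms.

(** A finite basis of the ideal of the low-order tuple, read as differential equations in n
    unknowns, is solved in Q by the elements c of order 0. A solution in K annihilates the basis,
    hence the whole ideal, and so gives the specialization. *)
Lemma specialization_of_ex_closed m (K : fieldType) (d : 'I_m -> K -> K) : (0 < m)%N ->
  commuting_derivations d -> ex_closed_mDF d -> specialization_property d.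
Proof.
move=> m_gt0 [Hd d_comm] ec r n r_gt0 n_gt0 L iota a a_diff Hmin.
have [F [j [kappa [alpha [delta [jk ja F_gen dd [dK da]]]]]]] :=
  derived_field Hd m_gt0 n_gt0 r_gt0 a_diff.
have lead_low := min_leader_low Hmin.
have [Q [e [t [Q_gen Q_ext]]]] :=
  InfiniteVariables.transcendental_extension F ('X_{1..m} * 'I_n)%type.
have [D [c [HD DK c_lo Dc]]] := differential_extension (Ordinal m_gt0) r_gt0 d_comm jk ja F_gen
  dd dK da lead_low Q_gen Q_ext.
pose eK : {rmorphism K -> Q} := GRing.RMorphism.clone _ _ (e \o kappa) _.
pose y k := c (0%MM, k).
have yE (v : 'X_{1..m} * 'I_n) : dpow D v.1 (y v.2) = c v.
  case: v => x k /=; elim/mnm_ind: x => [|i x IH].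
    by rewrite -[RHS](dpow0 D); apply: dpow_ext => i; rewrite mnm0E.
  transitivity (D i (dpow D x (y k))); last by rewrite IH Dc.
  by apply: (dpowS (proj2 HD)) => l; rewrite mnmDE mnm1E.
pose N := #|{: Idx m r n}|.
pose low (k : 'I_N) := (absx (enum_val k : Idx m r n).1 < 2 * r)%N.
(* Indices of order 2r or more, junk included, get the value 0, here and in [beta]; the polynomials
   to be specialized do not contain them. *)
pose g (k : 'I_N) : dterm m n K := if low k
  then dpow (fun i => @DDer m n K i) (fun i => (enum_val k).1 i : nat) (DVar _ _ (enum_val k).2)
  else DConst _ _ 0.
pose beta (k : 'I_N) := if low k then alpha (idx_to_j (enum_val k)) else 0.
pose I (f : {mpoly K[N]}) := mmap kappa beta f = 0.
have [||B [BI HB]] := @hilbert_basis K N I.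
- by move=> f1 f2 h1 h2; rewrite /I mmapB h1 h2 subrr.
- by move=> f1 f2 h2; rewrite /I (rmorphM (mmap kappa beta)) /= h2 mulr0.
have [T TP] := choice_fun (mpoly_dterm g).
(* One equation for each basis element and no inequations. *)
have [|b [hb _]] := ec n (size B) 0%N (fun k => T (tnth (in_tuple B) k)) (fun _ => DConst _ _ 0).
  exists Q, D, eK; split=> //; split; first exact: DK.
  exists y; split=> [k|[]//].
  have -> : deval eK D y (T (tnth (in_tuple B) k)) = e (mmap kappa beta (tnth (in_tuple B) k)).
    rewrite TP (mmap_rmorph (iota := eK)) //; apply: (mmap_agree eK (V := xpredT)) => // l _.
    rewrite /g /beta; case: ifP => hl; last by rewrite /= !rmorph0.
    rewrite deval_dpow /= -c_lo ?mdeg_idx // -yE /=; apply: dpow_ext => i.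
    by rewrite mnmE.
  by rewrite BI ?rmorph0 // mem_tnth.
exists b => f fv ef.
have If : I f.
  apply: (fmorph_inj j); rewrite rmorph0 (mmap_rmorph (iota := iota)) // -[RHS]ef.
  apply: (mmap_agree iota (V := low)) => [x hx k nk|k hk]; first exact: (fv x hx).
  by rewrite /beta hk ja ?mdeg_idx // aJ_idx.
have Zf : mmap idfun (fun k => deval idfun d b (g k)) f = 0.
  apply: (HB (fun f => mmap idfun (fun k => deval idfun d b (g k)) f = 0)) If.
  - by rewrite mmap0.
  - by move=> f1 f2 h1 h2; rewrite mmapD h1 h2 addr0.
  - by move=> f1 f2 h2; rewrite (rmorphM (mmap idfun _)) /= h2 mulr0.
  - move=> f1 /(nthP 0) [k hk <-]; rewrite -(TP _ K d idfun b).
    by have := hb (Ordinal hk); rewrite (tnth_nth 0).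
rewrite -[RHS]Zf; apply: (@mmap_agree _ _ idfun _ low) => [x hx k nk|k hk].
  exact: (fv x hx).
by rewrite /g hk deval_dpow.
Qed.

Theorem theorem4p5 (m : nat) (hm : (0 < m)%N) (K : fieldType) (d : 'I_m -> K -> K)
  (hd : commuting_derivations d) :
  ex_closed_mDF d <->
  (forall (r n : nat), (0 < r)%N -> (0 < n)%N ->
   forall (L : fieldType) (iota : {rmorphism K -> L}) (a : Idx m r n -> L),
     diff_condition d iota a ->
     (forall s : Idx m r n, (absx s.1 <= 2 * r)%N -> min_sep_leader iota a s ->
        (absx s.1 <= r)%N) ->
     exists b : 'I_n -> K, is_specialization d iota a b).
Proof.
split; first exact: specialization_of_ex_closed.
exact: ex_closed_of_specialization.
Qed.
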